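(* Consider the linear stochastic system, the open-loop problem and the closed-loop indirect-feedback MPC algorithm described in the context. Assume that the following holds. (i) The set $\mathbb{Z}_f\subseteq\mathbb{R}^n$ is nonempty, and for all $z\in\mathbb{Z}_f$ and $i=1,\ldots,m_x$: $c_i^\top z\le p_i-\sup_{j\in\mathbb{N}_0}\rho(c_i^\top E_j)$. (ii) There exists $v_f\in\mathbb{V}$ such that for all $z\in\mathbb{Z}_f$: $(A+BK)z+Bv_f+\mathbb{E}[W(0)]\in\mathbb{Z}_f$, and $d_i^\top(Kz+v_f)\le q_i-\sup_{j\in\mathbb{N}_0}\rho(d_i^\top KE_j)$ for $i=1,\ldots,m_u$. (iii) There exist a stationary pair $(\mathbf{X}^s,\mathbf{U}^s)$ and a constant $C_f\ge0$ such that, with $v_f$ from (ii), for all $X\in\mathcal{R}(\Omega,\mathbb{R}^n)$ (independent of $W(N)$) $$F(AX+B(KX+v_f)+W(N))\le F(X)-\ell(X,KX+v_f)+\ell(\mathbf{X}^s,\mathbf{U}^s)+C_f .$$ Assume also that the initial state is feasible, i.e. the open-loop problem is feasible at time $j=0$. Then $$\limsup_{L\to\infty}\frac1L\sum_{k=0}^{L-1}\ell(X^{cl}(k),U^{cl}(k))\le\ell(\mathbf{X}^s,\mathbf{U}^s)+C_f .$$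
   Context: Setting. $(\Omega,\mathcal{F},\mathbb{P})$ is a probability space and $\mathcal{R}(\Omega,\mathcal{Y})$ is the set of $\mathcal{Y}$-valued random variables. $A\in\mathbb{R}^{n\times n}$, $B\in\mathbb{R}^{n\times l}$, $(A,B)$ controllable. The system is $X(k+1)=AX(k)+BU(k)+W(k)$, $X(0)=X_0\in\mathcal{R}(\Omega,\mathbb{R}^n)$, where $W(0),W(1),\ldots$ are i.i.d. $\mathbb{R}^n$-valued random variables with finite mean (not necessarily Gaussian), $\mathcal{F}_k=\sigma(X(0),\ldots,X(k))$, controls are adapted ($\sigma(U(k))\subseteq\mathcal{F}_k$), and $W(k)$ is independent of $X(k)$ and of every admissible (i.e. $\mathcal{F}_k$-measurable) $U(k)$, so $W(k)$ is independent of $\mathcal{F}_k$. The stage cost is $\ell(X,U)=\mathbb{E}[g(X,U)]$ with $g:\mathbb{R}^n\times\mathbb{R}^l\to\mathbb{R}$ continuous and bounded from below; the terminal cost is $F(X)=\mathbb{E}[g_f(X)]$ with $g_f:\mathbb{R}^n\to\mathbb{R}$. Risk measure. $\rho:\mathcal{R}(\Omega,\mathbb{R})\to\mathbb{R}\cup\{+\infty\}$ is translative ($\rho(Y+c)=\rho(Y)+c$ for $c\in\mathbb{R}$), monotone ($\rho(Y_1)\ge\rho(Y_2)$ if $Y_1\ge Y_2$ a.s.) and law-invariant ($\rho(Y)=\rho(Z)$ if $Y\sim Z$). Given are $c_i\in\mathbb{R}^n$, $p_i\in\mathbb{R}$ ($i=1,\ldots,m_x$) and $d_i\in\mathbb{R}^l$,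 $q_i\in\mathbb{R}$ ($i=1,\ldots,m_u$). The risk-averse constraints are $\rho(c_i^\top X)\le p_i$ ($i=1,\ldots,m_x$), $\rho(d_i^\top U)\le q_i$ ($i=1,\ldots,m_u$). Stationary pair. A pair of processes $(\mathbf{X}^s,\mathbf{U}^s)$ with $X^s(k+1)=AX^s(k)+BU^s(k)+W(k)$ and $U^s(k)=\pi^s(X^s(k))$ for a feedback map $\pi^s$ is stationary if $X^s(k)$, $U^s(k)$ satisfy the risk-averse constraints for all $k$ and there are probability distributions $P^s_X,P^s_U,P^s_{X,U}$ with $X^s(k)\sim P^s_X$, $U^s(k)\sim P^s_U$, $(X^s(k),U^s(k))\sim P^s_{X,U}$ for all $k\in\mathbb{N}_0$. Then $\ell(\mathbf{X}^s,\mathbf{U}^s)$ denotes the ($k$-independent) value $\ell(X^s(k),U^s(k))$. Open-loop problem. Fix a stabilizing gain $K\in\mathbb{R}^{l\times n}$ (all eigenvalues of $A+BK$ lie in the open unit disc), $\mathbb{V}\subseteq\mathbb{R}^l$, $\mathbb{Z}_f\subseteq\mathbb{R}^n$ and a horizon $N\in\mathbb{N}$, $N\ge1$. At time $j$, for data $x_j\in\mathbb{R}^n$, $z_j\in\mathbb{R}^n$, $E_j\in\mathcal{R}(\Omega,\mathbb{R}^n)$, minimize over $\mathbf{v}=(v_0,\ldots,v_{N-1})\in\mathbb{V}^N$ the cost $\sum_{k=0}^{N-1}\ell(X(k),U(k))+F(X(N))$ subject to: $X(0)=x_j$, $X(k+1)=(A+BK)X(k)+Bv_k+W(j+k)$,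 $U(k)=KX(k)+v_k$; $z(0)=z_j$, $z(k+1)=(A+BK)z(k)+Bv_k+\mathbb{E}[W(j+k)]$; $E(0)=E_j$, $E(k+1)=(A+BK)E(k)+W(j+k)-\mathbb{E}[W(j+k)]$; $z(N)\in\mathbb{Z}_f$; and for $k=0,\ldots,N-1$: $c_i^\top z(k)\le p_i-\rho(c_i^\top E(k))$ ($i=1,\ldots,m_x$), $d_i^\top(Kz(k)+v_k)\le q_i-\rho(d_i^\top KE(k))$ ($i=1,\ldots,m_u$). The problem is feasible if some $\mathbf{v}$ satisfies all these constraints. Closed-loop algorithm. Initialize $X^{cl}(0)=X_0$, $Z^{cl}(0)=z_0=\mathbb{E}[X_0]$, $E_0=X_0-z_0$. For $j=0,1,\ldots$ and each $\omega$: with $x_j=X^{cl}(j,\omega)$, $z_j=Z^{cl}(j,\omega)$, solve the open-loop problem for $(x_j,z_j,E_j)$ to obtain an optimal solution $\mathbf{v}^*=(v_0^*,\ldots,v_{N-1}^* )$ (an optimal solution is presumed to exist whenever the problem is feasible); set $V^{cl}(j,\omega)=v_0^*$, $U^{cl}(j,\omega)=Kx_j+v_0^*$, $Z^{cl}(j+1,\omega)=(A+BK)z_j+Bv_0^*+\mathbb{E}[W(j)]$, $X^{cl}(j+1,\omega)=Ax_j+BU^{cl}(j,\omega)+W(j,\omega)$; and, as random variable, $E_{j+1}=(A+BK)E_j+W(j)-\mathbb{E}[W(j)]$. The controls are chosen measurably, so that $U^{cl}(j)$ and $Z^{cl}(j+1)$ are measurable with respect to $\sigma(X^{cl}(0)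,\ldots,X^{cl}(j))$.
   Formalization: The formal theorem assumes in addition that g_f is measurable and bounded below and that the optimal open-loop cost at time 0 has finite expectation over X_0 (the claim fails without these); the whole sequence v* is chosen measurably, and (iii) is required only for X with F(X) finite. *)

(* Defs.v *)
(* MathComp-Analysis development; random vectors are column vectors. *)
From HB Require Import structures.
From mathcomp Require Import all_boot all_order all_algebra.
From mathcomp Require Import all_classical all_reals all_analysis.
From mathcomp Require Import complex.

Set Implicit Arguments.
Unset Strict Implicit.
Unset Printing Implicit Defensive.

Import Order.TTheory GRing.Theory Num.Theory.
Import numFieldNormedType.Exports.

Local Open Scope classical_set_scope.
Local Open Scope ring_scope.

Definition dot (R : realType) (n : nat) (c x : 'cV[R]_n) : R := (c^T *m x) 0 0.

Section linear_systems.
Context (R : realType) (n l : nat).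

Fixpoint lin_state (A : 'M[R]_n) (B : 'M[R]_(n, l)) (x : 'cV[R]_n)
    (u : nat -> 'cV[R]_l) (k : nat) : 'cV[R]_n :=
  if k is k'.+1 then A *m lin_state A B x u k' + B *m u k' else x.

Definition controllable (A : 'M[R]_n) (B : 'M[R]_(n, l)) :=
  forall x y : 'cV[R]_n, exists (N : nat) (u : nat -> 'cV[R]_l),
    lin_state A B x u N = y.

Definition schur_stable (M : 'M[R]_n) :=
  forall z : R[i], eigenvalue (map_mx (real_complex R) M) z -> `|z| < 1.

End linear_systems.

(* R^n with its Borel sigma-algebra, the one generated by the open sets. *)
Definition borel_vec (R : realType) (n : nat) :=
  g_sigma_algebraType (@open 'cV[R]_n).

Section random_vectors.
Context d (Omega : measurableType d) (R : realType) (P : probability Omega R).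

Definition random_vector (n : nat) (X : Omega -> 'cV[R]_n) :=
  measurable_fun setT (X : Omega -> borel_vec R n).

Definition sigma_rv (n : nat) (X : Omega -> 'cV[R]_n) : set (set Omega) :=
  preimage_set_system setT (X : Omega -> borel_vec R n) measurable.

(* sigma(X 0, ..., X k) *)
Definition natural_filtration (n : nat) (X : nat -> Omega -> 'cV[R]_n)
    (k : nat) : set (set Omega) :=
  <<s \bigcup_(i in `I_k.+1) sigma_rv (X i) >>.

Definition independent_systems (S1 S2 : set (set Omega)) :=
  forall A B, S1 A -> S2 B -> P (A `&` B) = (P A * P B)%E.

Definition mutually_independent (n : nat) (W : nat -> Omega -> 'cV[R]_n) :=
  forall (s : seq nat) (D : nat -> set (borel_vec R n)), uniq s ->
    (forall i, measurable (D i)) ->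
    P (\big[setI/setT]_(i <- s) (W i @^-1` D i)) =
    (\prod_(i <- s) P (W i @^-1` D i))%E.

Definition has_law d' (T : measurableType d') (X : Omega -> T)
    (mu : probability T R) :=
  forall D : set T, measurable D -> P (X @^-1` D) = mu D.

Definition same_law d' (T : measurableType d') (X Y : Omega -> T) :=
  forall D : set T, measurable D -> P (X @^-1` D) = P (Y @^-1` D).

Definition iid (n : nat) (W : nat -> Omega -> 'cV[R]_n) :=
  mutually_independent W /\
  forall k, same_law (W k : Omega -> borel_vec R n) (W 0%N).

Definition finite_mean (n : nat) (X : Omega -> 'cV[R]_n) :=
  forall i, P.-integrable setT (fun w => (X w i 0)%:E).

Definition mean (n : nat) (X : Omega -> 'cV[R]_n) : 'cV[R]_n :=
  \col_i fine 'E_P[fun w => X w i 0].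

(* A risk measure acts on real random variables; its values at non-measurable
   functions are irrelevant and left unconstrained. *)
Record risk_measure (rho : (Omega -> R) -> \bar R) : Prop := RiskMeasure {
  risk_gtNy : forall Y : Omega -> R, measurable_fun setT Y -> rho Y != -oo%E ;
  risk_translative : forall (Y : Omega -> R) (c : R), measurable_fun setT Y ->
    rho (fun w => Y w + c) = (rho Y + c%:E)%E ;
  risk_monotone : forall Y1 Y2 : Omega -> R, measurable_fun setT Y1 ->
    measurable_fun setT Y2 -> {ae P, forall w, Y2 w <= Y1 w} ->
    (rho Y2 <= rho Y1)%E ;
  risk_law_invariant : forall Y Z : Omega -> R, measurable_fun setT Y ->
    measurable_fun setT Z -> same_law Y Z -> rho Y = rho Z }.

(* The expectations below are extended real. They are used with integrands
   bounded from below, hence take their values in ]-oo, +oo]. *)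
Definition stage_cost (n l : nat) (g : 'cV[R]_n * 'cV[R]_l -> R)
    (X : Omega -> 'cV[R]_n) (U : Omega -> 'cV[R]_l) : \bar R :=
  'E_P[fun w => g (X w, U w)].

Definition terminal_cost (n : nat) (gf : 'cV[R]_n -> R)
    (X : Omega -> 'cV[R]_n) : \bar R :=
  'E_P[fun w => gf (X w)].

End random_vectors.

Section stochastic_system.
Context d (Omega : measurableType d) (R : realType) (P : probability Omega R).
Context (n l : nat) (A : 'M[R]_n) (B : 'M[R]_(n, l)).
Context (W : nat -> Omega -> 'cV[R]_n).

Definition is_trajectory (X : nat -> Omega -> 'cV[R]_n)
    (U : nat -> Omega -> 'cV[R]_l) :=
  forall k w, X k.+1 w = A *m X k w + B *m U k w + W k w.

Definition adapted (X : nat -> Omega -> 'cV[R]_n)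
    (U : nat -> Omega -> 'cV[R]_l) :=
  forall k, sigma_rv (U k) `<=` natural_filtration X k.

Definition noise_independent (X0 : Omega -> 'cV[R]_n) :=
  forall X U, X 0%N = X0 -> is_trajectory X U -> adapted X U ->
    forall k, independent_systems P (sigma_rv (W k)) (natural_filtration X k).

Context (mx mu : nat) (c : 'I_mx -> 'cV[R]_n) (p : 'I_mx -> R).
Context (e : 'I_mu -> 'cV[R]_l) (q : 'I_mu -> R).
Context (rho : (Omega -> R) -> \bar R).

Definition risk_constraints (X : Omega -> 'cV[R]_n) (U : Omega -> 'cV[R]_l) :=
  (forall i, (rho (fun w => dot (c i) (X w)) <= (p i)%:E)%E) /\
  (forall i, (rho (fun w => dot (e i) (U w)) <= (q i)%:E)%E).

Record stationary_pair (Xs : nat -> Omega -> 'cV[R]_n)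
    (Us : nat -> Omega -> 'cV[R]_l) : Prop := StationaryPair {
  stat_random_state : forall k, random_vector (Xs k) ;
  stat_random_input : forall k, random_vector (Us k) ;
  stat_trajectory : is_trajectory Xs Us ;
  stat_feedback : exists pis : 'cV[R]_n -> 'cV[R]_l,
    forall k w, Us k w = pis (Xs k w) ;
  stat_constraints : forall k, risk_constraints (Xs k) (Us k) ;
  stat_laws : exists (PX : probability (borel_vec R n) R)
      (PU : probability (borel_vec R l) R)
      (PXU : probability (borel_vec R n * borel_vec R l)%type R),
    forall k, [/\ has_law P (Xs k : Omega -> borel_vec R n) PX,
      has_law P (Us k : Omega -> borel_vec R l) PU &
      has_law P (fun w => (Xs k w : borel_vec R n, Us k w : borel_vec R l))
        PXU] }.

Context (K : 'M[R]_(l, n)).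

Definition closed_gain : 'M[R]_n := A + B *m K.

Fixpoint error (X0 : Omega -> 'cV[R]_n) (j : nat) : Omega -> 'cV[R]_n :=
  if j is j'.+1 then
    fun w => closed_gain *m error X0 j' w + W j' w - mean P (W j')
  else fun w => X0 w - mean P X0.

(* Open-loop problem at time j. A control sequence is an N-tuple v, whose k-th
   entry is v`_k; the trajectories are only used up to time N, so that the
   default value of v`_k for N <= k plays no role. *)
Section open_loop.
Context (N : nat) (j : nat).
Implicit Type v : N.-tuple 'cV[R]_l.

Fixpoint ol_state (x : 'cV[R]_n) v (k : nat) : Omega -> 'cV[R]_n :=
  if k is k'.+1 then
    fun w => closed_gain *m ol_state x v k' w + B *m v`_k' + W (j + k') w
  else fun=> x.

Definition ol_input (x : 'cV[R]_n) v (k : nat) : Omega -> 'cV[R]_l :=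
  fun w => K *m ol_state x v k w + v`_k.

Fixpoint ol_nominal (z : 'cV[R]_n) v (k : nat) : 'cV[R]_n :=
  if k is k'.+1 then
    closed_gain *m ol_nominal z v k' + B *m v`_k' + mean P (W (j + k'))
  else z.

Fixpoint ol_error (E : Omega -> 'cV[R]_n) (k : nat) : Omega -> 'cV[R]_n :=
  if k is k'.+1 then
    fun w => closed_gain *m ol_error E k' w + W (j + k') w - mean P (W (j + k'))
  else E.

Definition ol_cost (g : 'cV[R]_n * 'cV[R]_l -> R) (gf : 'cV[R]_n -> R)
    (x : 'cV[R]_n) v : \bar R :=
  (\sum_(k < N) stage_cost P g (ol_state x v k) (ol_input x v k)
   + terminal_cost P gf (ol_state x v N))%E.

(* The constraints do not involve the measured state x. *)
Definition ol_admissible (V : set 'cV[R]_l) (Zf : set 'cV[R]_n)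
    (z : 'cV[R]_n) (E : Omega -> 'cV[R]_n) v :=
  [/\ forall k : 'I_N, V v`_k,
      Zf (ol_nominal z v N),
      forall (k : 'I_N) (i : 'I_mx),
        ((dot (c i) (ol_nominal z v k))%:E
         <= (p i)%:E - rho (fun w => dot (c i) (ol_error E k w)))%E &
      forall (k : 'I_N) (i : 'I_mu),
        ((dot (e i) (K *m ol_nominal z v k + v`_k))%:E
         <= (q i)%:E - rho (fun w => dot (e i) (K *m ol_error E k w)))%E].

Definition ol_feasible V Zf z E := exists v, ol_admissible V Zf z E v.

Definition ol_optimal g gf V Zf (x z : 'cV[R]_n) E v :=
  ol_admissible V Zf z E v /\
  forall v', ol_admissible V Zf z E v' ->
    (ol_cost g gf x v <= ol_cost g gf x v')%E.

End open_loop.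

(* Closed loop generated by the selected sequences vs j w, of which only the
   first entry is applied. *)
Section closed_loop.
Context (N : nat) (vs : nat -> Omega -> N.-tuple 'cV[R]_l).

Fixpoint cl_state (X0 : Omega -> 'cV[R]_n) (j : nat) : Omega -> 'cV[R]_n :=
  if j is j'.+1 then
    fun w => A *m cl_state X0 j' w
             + B *m (K *m cl_state X0 j' w + (vs j' w)`_0) + W j' w
  else X0.

Definition cl_input (X0 : Omega -> 'cV[R]_n) (j : nat) : Omega -> 'cV[R]_l :=
  fun w => K *m cl_state X0 j w + (vs j w)`_0.

Fixpoint cl_nominal (X0 : Omega -> 'cV[R]_n) (j : nat) : Omega -> 'cV[R]_n :=
  if j is j'.+1 then
    fun w => closed_gain *m cl_nominal X0 j' w + B *m (vs j' w)`_0
             + mean P (W j')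
  else fun=> mean P X0.

(* At each time and outcome the selected sequence solves the open-loop problem
   whenever the latter is feasible, and the selection is measurable with
   respect to the closed-loop states observed so far. *)
Definition mpc_selection g gf V Zf (X0 : Omega -> 'cV[R]_n) :=
  (forall j w, ol_feasible N j V Zf (cl_nominal X0 j w) (error X0 j) ->
     ol_optimal j g gf V Zf (cl_state X0 j w) (cl_nominal X0 j w) (error X0 j)
       (vs j w)) /\
  (forall j (k : 'I_N), sigma_rv (fun w => (vs j w)`_k)
     `<=` natural_filtration (cl_state X0) j).

End closed_loop.

End stochastic_system.

(* Main.v *)
Require Import Defs.
From HB Require Import structures.
From mathcomp Require Import all_boot all_order all_algebra.
From mathcomp Require Import all_classical all_reals all_analysis.
From mathcomp Require Import measurable_realfun.
From mathcomp Require Import lra.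

Set Implicit Arguments.
Unset Strict Implicit.
Unset Printing Implicit Defensive.

Import Order.TTheory GRing.Theory Num.Theory.
Import numFieldNormedType.Exports.

Local Open Scope classical_set_scope.
Local Open Scope ring_scope.

(** Shift g and gf so that they are nonnegative, and let J j be the expectation
of the optimal open-loop cost along the closed loop. As a function of the data
(x, v), the open-loop cost averages over the future noise only, which is
independent of the past that determines the closed-loop state and the selected
inputs; hence its expectation along the closed loop is the expected cost of the
actual path ("freezing", used at times j and j + 1). Shifting the optimal
sequence and appending vf gives an admissible sequence at time j + 1, whose cost
exceeds the remaining cost at time j by the cost of one more step. That step is
controlled by the terminal decrease pointwise in (x, v): since the noise is
i.i.d., the frozen cost does not depend on j, so the decrease is only needed for
the open-loop state started at time 0, which is independent of W N. This gives
J (j + 1) + l (X j, U j) <= J j + l^s + Cf, which telescopes. *)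

(** * Borel random vectors *)

Section borel_vectors.
Context d (T : measurableType d) (R : realType).

Lemma random_vector_coord n (X : T -> 'cV[R]_n) : random_vector X ->
  forall i, measurable_fun setT (fun t => X t i 0).
Proof.
move=> mX i; apply: (@measurableT_comp _ _ _ _ _ _
  ((fun x => x i 0) : borel_vec R n -> R) _ X) => //.
apply: (measurability (@RGenOInfty.G R)); first exact: RGenOInfty.measurableE.
move=> _ [_ [x ->] <-]; rewrite setTI; apply: sub_sigma_algebra.
apply: (@open_comp 'cV[R]_n R (fun x => x i 0)); last exact: interval_open.
by move=> y _; exact: coord_continuous.
Qed.

Let cube n (x : 'cV[R]_n) (e : R) : set 'cV[R]_n :=
  [set y | forall i, `|x i 0 - y i 0| < e].

Let rat_vec n (a : 'cV[rat]_n) : 'cV[R]_n := map_mx ratr a.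

Let measurable_cube n (X : T -> 'cV[R]_n) x e :
  (forall i, measurable_fun setT (fun t => X t i 0)) ->
  measurable (X @^-1` cube x e).
Proof.
move=> mX.
rewrite (_ : _ @^-1` _ = \bigcap_(i in [set: 'I_n])
    ((fun t => `|x i 0 - X t i 0|) @^-1` `]-oo, e[)).
  apply: fin_bigcap_measurable => // i _.
  rewrite -[_ @^-1` _]setTI.
  apply: (_ : measurable_fun setT (fun t => `|x i 0 - X t i 0|)) => //.
  apply: (@measurableT_comp _ _ _ _ _ _ (@Num.norm _ R)) => //.
  exact: measurable_funB.
apply/seteqP; split => t /=.
  by move=> h i _ /=; rewrite in_itv /=; exact: h.
by move=> h i; have := h i Logic.I; rewrite /= in_itv.
Qed.

Let rat_approx n (x : 'cV[R]_n) (e : R) : 0 < e ->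
  exists a : 'cV[rat]_n, cube (rat_vec a) e x.
Proof.
move=> e0.
have h (i : 'I_n) : exists q : rat, `|ratr q - x i 0| < e.
  have [|q] := @rat_in_itvoo R (x i 0 - e) (x i 0 + e).
    by rewrite ltrBlDr -addrA ltrDl addr_gt0.
  by rewrite in_itv /= => xq; exists q; rewrite ltr_distl.
have [f fP] := choice h.
by exists (\col_i f i) => i; rewrite /rat_vec !mxE.
Qed.

(** [O] is the countable union of the products of cubes with rational centres and common radius
    [1 / (k + 1)] that it contains, and the preimage of a cube is cut out by finitely many
    coordinate conditions. Treating open sets of the product directly makes jointly continuous costs
    measurable. *)
Lemma measurable_open_pair n l (X : T -> 'cV[R]_n) (Y : T -> 'cV[R]_l)
    (O : set ('cV[R]_n * 'cV[R]_l)) :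
  (forall i, measurable_fun setT (fun t => X t i 0)) ->
  (forall i, measurable_fun setT (fun t => Y t i 0)) ->
  open O -> measurable [set t | O (X t, Y t)].
Proof.
move=> mX mY oO.
(* Products that stick out of [O] are replaced by [set0], so that the union ranges over a whole
   countable type. *)
pose F (q : 'cV[rat]_n * 'cV[rat]_l * nat) : set T :=
  if `[< forall x y, cube (rat_vec q.1.1) q.2.+1%:R^-1 x ->
                     cube (rat_vec q.1.2) q.2.+1%:R^-1 y -> O (x, y) >]
  then X @^-1` cube (rat_vec q.1.1) q.2.+1%:R^-1
       `&` Y @^-1` cube (rat_vec q.1.2) q.2.+1%:R^-1 else set0.
rewrite (_ : [set t | _] = \bigcup_q F q).
  apply: countable_bigcupT_measurable => [|q]; first exact: countableP.
  rewrite /F; case: asboolP => _ //.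
  by apply: measurableI; exact: measurable_cube.
apply/seteqP; split => [t /= Ot|t [q _]]; last first.
  by rewrite /F; case: asboolP => // qO [Xt Yt] /=; exact: qO.
move: oO; rewrite openE => /(_ _ Ot); rewrite /interior => /nbhs_ballP[e /= e0 eO].
have e2 : 0 < e / 2 by rewrite divr_gt0.
(* Two points of one cube are compared through its centre, so each of the two distances may use half
   of [e]. *)
have [k ke] : exists k, k.+1%:R^-1 < e / 2.
  have := near_infty_natSinv_lt (PosNum e2).
  by case=> k _ /(_ _ (leqnn k)) /= ?; exists k.
have k0 : 0 < k.+1%:R^-1 :> R by rewrite invr_gt0.
have [a aX] := rat_approx (X t) k0; have [b bY] := rat_approx (Y t) k0.
exists (a, b, k) => //; rewrite /F /=; case: asboolP => // -[] x y ax bby.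
have tri m (c : 'cV[R]_m) z z' : cube c k.+1%:R^-1 z -> cube c k.+1%:R^-1 z' ->
    ball z e z'.
  move=> cz cz'; split => // i j; rewrite !ord1 /ball /=.
  rewrite -[_ - _](subrKA (c i 0)) (le_lt_trans (ler_normD _ _))//.
  rewrite [ltRHS]splitr distrC ltrD//.
    by rewrite (lt_trans (cz i)).
  by rewrite (lt_trans (cz' i)).
apply: eO; split => /=; [apply: (tri _ _ _ _ aX ax)|apply: (tri _ _ _ _ bY bby)].
Qed.

Lemma coord_random_vector n (X : T -> 'cV[R]_n) :
  (forall i, measurable_fun setT (fun t => X t i 0)) -> random_vector X.
Proof.
move=> mX; apply: (@measurability _ _ _ (borel_vec R n) _ _ (@open 'cV[R]_n)) => // _ [U oU <-].
rewrite setTI.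
(* A second component of dimension zero reduces single vectors to pairs. *)
have := @measurable_open_pair n 0 X (fun=> 0) (fst @^-1` U) mX.
apply; first by case.
by apply: open_comp => // x _; exact: cvg_fst.
Qed.

Lemma measurable_fun_continuous_pair n l (g : 'cV[R]_n * 'cV[R]_l -> R)
    (X : T -> 'cV[R]_n) (Y : T -> 'cV[R]_l) :
  continuous g -> random_vector X -> random_vector Y ->
  measurable_fun setT (fun t => g (X t, Y t)).
Proof.
move=> cg mX mY.
apply: (measurability (@RGenOInfty.G R)); first exact: RGenOInfty.measurableE.
move=> _ [_ [x ->] <-]; rewrite setTI.
apply: (@measurable_open_pair _ _ X Y (g @^-1` `]x, +oo[)).
- exact: random_vector_coord.
- exact: random_vector_coord.
- apply: open_comp; first by move=> y _; exact: cg.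
  exact: interval_open.
Qed.

Lemma random_vector_cst n (x : 'cV[R]_n) : random_vector (fun _ : T => x).
Proof. exact: measurable_cst. Qed.

Lemma random_vectorD n (X Y : T -> 'cV[R]_n) : random_vector X ->
  random_vector Y -> random_vector (fun t => X t + Y t).
Proof.
move=> mX mY; apply: coord_random_vector => i.
rewrite (_ : (fun _ => _) = (fun t => X t i 0 + Y t i 0)).
  by apply: measurable_funD; exact: random_vector_coord.
by apply/funext => t; rewrite mxE.
Qed.

Lemma random_vector_mulmx n m (M : 'M[R]_(m, n)) (X : T -> 'cV[R]_n) :
  random_vector X -> random_vector (fun t => M *m X t).
Proof.
move=> mX; apply: coord_random_vector => i.
rewrite (_ : (fun _ => _) = (fun t => \sum_j M i j * X t j 0)).
  apply: measurable_sum => j; apply: measurable_funM => //.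
  exact: random_vector_coord.
by apply/funext => t; rewrite mxE.
Qed.

Lemma random_vectorN n (X : T -> 'cV[R]_n) : random_vector X ->
  random_vector (fun t => - X t).
Proof.
move=> mX; rewrite (_ : (fun _ => _) = (fun t => (- 1%:M) *m X t)).
  exact: random_vector_mulmx.
by apply/funext => t; rewrite mulNmx mul1mx.
Qed.

Lemma random_vector_comp d' (T' : measurableType d') n (X : T -> 'cV[R]_n)
    (f : T' -> T) :
  measurable_fun setT f -> random_vector X -> random_vector (X \o f).
Proof. by move=> mf mX; exact: (measurableT_comp mX mf). Qed.

End borel_vectors.

(** * Independence and freezing *)

Section laws.
Local Open Scope ereal_scope.
Context d (Omega : measurableType d) (R : realType) (P : probability Omega R).
Context d1 (T1 : measurableType d1).

Lemma ge0_integral_law (Y : Omega -> T1) (h : T1 -> \bar R) :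
  forall mY : measurable_fun setT Y,
  measurable_fun setT h -> (forall y, 0 <= h y) ->
  \int[distribution P (mfun_Sub (mem_set mY))]_y h y = \int[P]_w h (Y w).
Proof. by move=> mY mh h0; rewrite ge0_integral_pushforward. Qed.

Lemma same_law_integral (Y Y' : Omega -> T1) (h : T1 -> \bar R) :
  measurable_fun setT Y -> measurable_fun setT Y' -> same_law P Y Y' ->
  measurable_fun setT h -> (forall y, 0 <= h y) ->
  \int[P]_w h (Y w) = \int[P]_w h (Y' w).
Proof.
move=> mY mY' YY' mh h0.
rewrite -(ge0_integral_law mY)// -(ge0_integral_law mY')//.
by apply: eq_measure_integral => D mD _; exact: YY'.
Qed.

(** The integral is the difference of those of the positive and negative parts, each of which
    depends on the law only. This serves to compare means. *)
Lemma same_law_integral_signed (Y Y' : Omega -> T1) (h : T1 -> \bar R) :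
  measurable_fun setT Y -> measurable_fun setT Y' -> same_law P Y Y' ->
  measurable_fun setT h -> \int[P]_w h (Y w) = \int[P]_w h (Y' w).
Proof.
move=> mY mY' YY' mh; rewrite integralE [in RHS]integralE.
have pos (Z : Omega -> T1) : \int[P]_w (fun w => h (Z w))^\+ w
    = \int[P]_w (h^\+ (Z w)).
  by apply: eq_integral => w _; rewrite !funeposE.
have neg (Z : Omega -> T1) : \int[P]_w (fun w => h (Z w))^\- w
    = \int[P]_w (h^\- (Z w)).
  by apply: eq_integral => w _; rewrite !funenegE.
rewrite !pos !neg; congr (_ - _).
  apply: (same_law_integral mY mY' YY'); first exact: measurable_funepos.
  by move=> y; exact: funepos_ge0.
apply: (same_law_integral mY mY' YY'); first exact: measurable_funeneg.
by move=> y; exact: funeneg_ge0.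
Qed.

End laws.

(** * Product laws and Tonelli for independent pairs *)

Section independent_pairs.
Local Open Scope ereal_scope.
Context d (Omega : measurableType d) (R : realType) (P : probability Omega R).
Context d1 (T1 : measurableType d1) d2 (T2 : measurableType d2).

Definition independent_pair (Y : Omega -> T1) (Z : Omega -> T2) :=
  forall A B, measurable A -> measurable B ->
    P (Y @^-1` A `&` Z @^-1` B) = P (Y @^-1` A) * P (Z @^-1` B).

Lemma measurable_fun_integral_law (Z : Omega -> T2) (h : T1 * T2 -> \bar R) :
  measurable_fun setT Z -> measurable_fun setT h -> (forall y, 0 <= h y) ->
  measurable_fun setT (fun y => \int[P]_w h (y, Z w)).
Proof.
move=> mZ mh h0.
rewrite (_ : (fun _ => _)
    = fubini_F (distribution P (mfun_Sub (mem_set mZ))) h).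
  exact: measurable_fun_fubini_tonelli_F.
apply/funext => y; rewrite /fubini_F [RHS]ge0_integral_law//.
exact: measurable_fun_pair2.
Qed.

(** The joint law agrees with the product of the marginal laws on rectangles, hence everywhere;
    Tonelli then integrates the second variable first. *)
Lemma independent_pair_integral (Y : Omega -> T1) (Z : Omega -> T2)
    (h : T1 * T2 -> \bar R) :
  measurable_fun setT Y -> measurable_fun setT Z -> independent_pair Y Z ->
  measurable_fun setT h -> (forall y, 0 <= h y) ->
  \int[P]_w h (Y w, Z w) = \int[P]_w \int[P]_w' h (Y w, Z w').
Proof.
move=> mY mZ YZ mh h0.
pose QY := distribution P (mfun_Sub (mem_set mY)).
pose QZ := distribution P (mfun_Sub (mem_set mZ)).
have mYZ : measurable_fun setT (fun w => (Y w, Z w)).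
  exact: measurable_fun_pair.
transitivity (\int[QY \x QZ]_y h y).
  rewrite -(ge0_integral_law P mYZ)//.
  apply: eq_measure_integral => D mD _; apply/esym.
  apply: product_measure_unique => // A B mA mB; exact: YZ.
rewrite fubini_tonelli1// /fubini_F.
rewrite [LHS]ge0_integral_law; last 2 first.
- exact: measurable_fun_fubini_tonelli_F.
- by move=> y; apply: integral_ge0.
apply: eq_integral => w _; rewrite [LHS]ge0_integral_law//.
exact: measurable_fun_pair2.
Qed.

End independent_pairs.

(** Under independence the joint law is determined by the marginals: in the iterated integral of an
    indicator, [Y] is exchanged for [Y'] outside, then [Z] for [Z'] inside. *)
Lemma independent_pair_same_law d (Omega : measurableType d) (R : realType)
    (P : probability Omega R) d1 (T1 : measurableType d1)
    d2 (T2 : measurableType d2) d3 (T3 : measurableType d3)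
    (Y Y' : Omega -> T1) (Z Z' : Omega -> T2) (f : T1 * T2 -> T3) :
  measurable_fun setT Y -> measurable_fun setT Y' ->
  measurable_fun setT Z -> measurable_fun setT Z' ->
  measurable_fun setT f ->
  independent_pair P Y Z -> independent_pair P Y' Z' ->
  same_law P Y Y' -> same_law P Z Z' ->
  same_law P (fun w => f (Y w, Z w)) (fun w => f (Y' w, Z' w)).
Proof.
move=> mY mY' mZ mZ' mf YZ YZ' YY' ZZ' D mD.
pose h y : \bar R := (\1_(f @^-1` D) y)%:E.
have mh : measurable_fun setT h.
  apply/measurable_EFinP/measurable_indic.
  by rewrite -[_ @^-1` _]setTI; exact: mf.
have h0 y : (0 <= h y)%E by rewrite lee_fin.
have E (U : Omega -> T1) (V : Omega -> T2) :
    measurable_fun setT U -> measurable_fun setT V ->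
    P ((fun w => f (U w, V w)) @^-1` D) = (\int[P]_w h (U w, V w))%E.
  move=> mU mV; rewrite -[in LHS](setIT (_ @^-1` _)) -integral_indic//.
  have mUV : measurable_fun setT (fun w => f (U w, V w)).
    by apply: (measurableT_comp mf); exact: measurable_fun_pair.
  by rewrite -[_ @^-1` _]setTI; exact: mUV.
rewrite !E//.
transitivity (\int[P]_w \int[P]_w' h (Y w, Z w'))%E.
  exact: independent_pair_integral.
transitivity (\int[P]_w \int[P]_w' h (Y' w, Z' w'))%E; last first.
  by apply/esym; exact: independent_pair_integral.
transitivity (\int[P]_w \int[P]_w' h (Y' w, Z w'))%E.
  apply: (same_law_integral mY mY' YY'
    (h := fun y => (\int[P]_w h (y, Z w))%E)).
  - exact: measurable_fun_integral_law.
  - by move=> y; exact: integral_ge0.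
apply: eq_integral => w _.
apply: (same_law_integral mZ mZ' ZZ' (h := fun z => h (Y' w, z))) => //.
exact: measurable_fun_pair2.
Qed.

(** * Independence of the past from a window of future noise *)

Section sigma_algebra_independence.
Local Open Scope ereal_scope.
Context d (Omega : measurableType d) (R : realType) (P : probability Omega R).

(** As functions of [B], both sides are finite measures: [P] restricted to [A], and a multiple of
    [P]. They agree on the pi-system [C], hence on the sigma-algebra it generates. *)
Lemma g_sigma_algebra_indep (A : set Omega) (C : set (set Omega)) :
  measurable A -> C `<=` measurable -> setI_closed C -> C setT ->
  (forall B, C B -> P (A `&` B) = P A * P B) ->
  forall B, <<s C >> B -> P (A `&` B) = P A * P B.
Proof.
move=> mA mC CI CT AC B CB.
have PA0 : (0 <= fine (P A))%R by rewrite fine_ge0.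
pose m1 := mrestr P mA.
pose m2 := mscale (NngNum PA0) P.
have m12 D : C D -> m1 D = m2 D.
  by move=> CD; rewrite /m1 /m2 /mrestr /mscale /= setIC AC// fineK// fin_num_measure.
have -> : P (A `&` B) = m1 B by rewrite /m1 /mrestr /= setIC.
have -> : P A * P B = m2 B by rewrite /m2 /mscale /= fineK// fin_num_measure.
apply: (g_sigma_algebra_measure_unique C mC (fun=> setT)) => //.
- by rewrite bigcup_const//; exists 0%N.
- move=> _; change (P (setT `&` A) < +oo).
  by rewrite setTI (le_lt_trans (probability_le1 P mA))// ltry.
Qed.

(* A \perp B and sigma(A, B) \perp C imply A \perp sigma(B, C), iterated. *)
Lemma independent_windows (F S : nat -> set (set Omega)) (j : nat) :
  (forall k, F k `<=` measurable) -> (forall k, sigma_algebra setT (F k)) ->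
  (forall k, sigma_algebra setT (S k)) -> (forall k, F k `<=` F k.+1) ->
  (forall k, S k `<=` F k.+1) -> (forall k, independent_systems P (S k) (F k)) ->
  forall m, independent_systems P (F j)
    <<s \bigcup_(i in `I_m) S (j + i)%N >>.
Proof.
move=> mF sF sS FS SF SFk m.
pose G m := \bigcup_(i in `I_m) S (j + i)%N.
have FF k i : F k `<=` F (k + i)%N.
  by elim: i => [|i IH]; rewrite ?addn0// addnS => B /IH; exact: FS.
have GF i : <<s G i >> `<=` F (j + i)%N.
  apply: smallest_sub => // B [k /= ki SB].
  by rewrite -(subnKC ki) addnA addnS; exact/FF/SF.
have FI k : setI_closed (F k).
  move=> B B' FB FB'; have := @measurableI _ (g_sigma_algebraType (F k)) B B'.
  by rewrite /measurable /= (sigma_algebra_id (sF k)); apply.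
have SI k : setI_closed (S k).
  move=> B B' FB FB'; have := @measurableI _ (g_sigma_algebraType (S k)) B B'.
  by rewrite /measurable /= (sigma_algebra_id (sS k)); apply.
have FT k : F k setT.
  have := @measurableT _ (g_sigma_algebraType (F k)).
  by rewrite /measurable /= (sigma_algebra_id (sF k)).
have ST k : S k setT.
  have := @measurableT _ (g_sigma_algebraType (S k)).
  by rewrite /measurable /= (sigma_algebra_id (sS k)).
rewrite -/(G m); elim: m => [|m IH] A B FA.
  (* The empty window generates the trivial sigma-algebra, which is independent of everything. *)
  rewrite (_ : G 0%N = set0) => [GB|]; last first.
    by apply/seteqP; split => // D [].
  have sm : <<s set0 >> `<=` [set set0; setT : set Omega].
    apply: smallest_sub => //; split; first by left.
      by move=> D [->|->]; [right; rewrite setD0|left; rewrite setDv].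
    move=> D DE; have [[n Dn]|nD] := pselect (exists n, D n = setT).
      by right; apply/seteqP; split => // x _; exists n => //; rewrite Dn.
    left; apply/seteqP; split => // x [n _ Dx].
    by have [D0|DT] := DE n; [move: Dx; rewrite D0|case: nD; exists n].
  have [->|->] := sm _ GB; first by rewrite setI0 measure0 mule0.
  by rewrite setIT probability_setT mule1.
(* Intersections of an event of the window of length [m] with an event of the next system form a
   pi-system generating the window of length [m + 1]. *)
pose C := [set D | exists B1 B2, [/\ <<s G m >> B1, S (j + m)%N B2 &
  D = B1 `&` B2]].
have mFB k D : F k D -> measurable D by exact: mF.
move=> GB; apply: (@g_sigma_algebra_indep A C) => //.
- exact: mFB FA.
- move=> _ [B1 [B2 [GB1 SB2 ->]]]; apply: measurableI.
    by apply: mFB; exact: GF GB1.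
  by apply: mFB; exact: SF SB2.
- move=> _ _ [B1 [B2 [GB1 SB2 ->]]] [B1' [B2' [GB1' SB2' ->]]].
  exists (B1 `&` B1'), (B2 `&` B2'); split; last by rewrite setIACA.
    exact: (@measurableI _ (g_sigma_algebraType (G m))).
  exact: SI.
- exists setT, setT; split => //; last by rewrite setIT.
  exact: (@measurableT _ (g_sigma_algebraType (G m))).
- move=> _ [B1 [B2 [GB1 SB2 ->]]].
  (* Both [A] and [B1] belong to the past of the last system, so [B2] splits off from [A] and [B1]
     together; the induction hypothesis then separates [A] from [B1]. *)
  have FAB : F (j + m)%N (A `&` B1) by apply: FI; [exact: FF|exact: GF].
  rewrite [in LHS]setIA [in LHS]setIC [in RHS]setIC.
  rewrite (SFk _ _ _ SB2 FAB) (SFk _ _ _ SB2 (GF _ _ GB1)).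
  by rewrite (IH _ _ FA GB1) muleCA.
- have : <<s C >> B; last by [].
  apply: (smallest_sub _ _ GB); first exact: smallest_sigma_algebra.
  move=> D [i /= im SD]; apply: sub_sigma_algebra.
  move: im; rewrite ltnS leq_eqVlt => /predU1P[im|im].
    exists setT, D; split; last by rewrite setTI.
      exact: (@measurableT _ (g_sigma_algebraType (G m))).
    by rewrite -im.
  exists D, setT; split; [|exact: ST|by rewrite setIT].
  by apply: sub_sigma_algebra; exists i.
Qed.

End sigma_algebra_independence.

(** * Trajectories and frozen costs *)

Section trajectories.
Context (R : realType) (n l : nat) (M : 'M[R]_n) (B : 'M[R]_(n, l)).
Context (K : 'M[R]_(l, n)).
Implicit Types (x : 'cV[R]_n) (u : nat -> 'cV[R]_l) (w : nat -> 'cV[R]_n).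

(** A pathwise recursion with the noise as an argument: open-loop states, nominal states and steps
    of the closed loop are all instances of it. *)
Fixpoint traj x u w (k : nat) : 'cV[R]_n :=
  if k is k'.+1 then M *m traj x u w k' + B *m u k' + w k' else x.

Lemma traj_shift x u w k :
  traj x u w k.+1
  = traj (traj x u w 1) (fun i => u i.+1) (fun i => w i.+1) k.
Proof. by elim: k => //= k <-. Qed.

Lemma eq_traj x u u' w w' k :
  (forall i, (i < k)%N -> u i = u' i) -> (forall i, (i < k)%N -> w i = w' i) ->
  traj x u w k = traj x u' w' k.
Proof.
elim: k => //= k IH uu' ww'; rewrite uu'// ww'// IH// => i ik.
  by rewrite uu'// ltnW.
by rewrite ww'// ltnW.
Qed.

(** Here [u] is the offset to the feedback [K *m x]: the stage cost sees the full input, while in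
    the dynamics the feedback is part of [M], later taken to be [A + B *m K]. *)
Definition path_cost (g : 'cV[R]_n * 'cV[R]_l -> R) (gf : 'cV[R]_n -> R)
    (m : nat) x u w : R :=
  \sum_(k < m) g (traj x u w k, K *m traj x u w k + u k) + gf (traj x u w m).

(** Dynamic programming along a single path: the tail restarts from the state after one step, with
    inputs and noise shifted by one. *)
Lemma path_cost_shift g gf m x u w :
  g (x, K *m x + u 0%N)
  + path_cost g gf m (traj x u w 1) (fun i => u i.+1) (fun i => w i.+1)
  = path_cost g gf m.+1 x u w.
Proof.
rewrite /path_cost big_ord_recl addrA (traj_shift x u w m).
congr (_ + _ + _).
by apply: eq_bigr => i _; rewrite lift0 (traj_shift x u w i); reflexivity.
Qed.

Lemma path_cost_ge0 g gf m x u w : (forall y, 0 <= g y) ->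
  (forall y, 0 <= gf y) -> 0 <= path_cost g gf m x u w.
Proof. by move=> g0 gf0; rewrite addr_ge0// sumr_ge0. Qed.

Lemma eq_path_cost g gf m x u u' w :
  (forall i, (i < m)%N -> u i = u' i) ->
  path_cost g gf m x u w = path_cost g gf m x u' w.
Proof.
move=> uu'; rewrite /path_cost (@eq_traj x u u' w w m)//; congr (_ + _).
apply: eq_bigr => i _; rewrite uu'// (@eq_traj _ _ u' _ w)// => k ki.
by rewrite uu'// (ltn_trans ki).
Qed.

Section measurability.
Context d (T : measurableType d).
Variables (x : T -> 'cV[R]_n) (u : nat -> T -> 'cV[R]_l).
Variables (w : nat -> T -> 'cV[R]_n).

Lemma random_vector_traj k : random_vector x ->
  (forall i, (i < k)%N -> random_vector (u i)) ->
  (forall i, (i < k)%N -> random_vector (w i)) ->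
  random_vector (fun t => traj (x t) (u^~ t) (w^~ t) k).
Proof.
move=> mx; elim: k => //= k IH mu mw.
have mk : random_vector (fun t => traj (x t) (u^~ t) (w^~ t) k).
  by apply: IH => i ik; [apply: mu|apply: mw]; rewrite ltnW.
apply: random_vectorD; last exact: mw.
by apply: random_vectorD; apply: random_vector_mulmx => //; exact: mu.
Qed.

Lemma measurable_stage (g : 'cV[R]_n * 'cV[R]_l -> R) k : continuous g -> random_vector x ->
  (forall i, (i <= k)%N -> random_vector (u i)) ->
  (forall i, (i < k)%N -> random_vector (w i)) ->
  measurable_fun setT (fun t =>
    g (traj (x t) (u^~ t) (w^~ t) k, K *m traj (x t) (u^~ t) (w^~ t) k + u k t)).
Proof.
move=> cg mx mu mw.
have mk : random_vector (fun t => traj (x t) (u^~ t) (w^~ t) k).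
  by apply: random_vector_traj => // i ik; apply: mu; exact: ltnW.
apply: measurable_fun_continuous_pair => //.
by apply: random_vectorD; [exact: random_vector_mulmx|exact: mu].
Qed.

Lemma measurable_path_cost (g : 'cV[R]_n * 'cV[R]_l -> R)
    (gf : 'cV[R]_n -> R) m : continuous g ->
  measurable_fun setT (gf : borel_vec R n -> R) -> random_vector x ->
  (forall i, (i < m)%N -> random_vector (u i)) ->
  (forall i, (i < m)%N -> random_vector (w i)) ->
  measurable_fun setT (fun t => path_cost g gf m (x t) (u^~ t) (w^~ t)).
Proof.
move=> cg mgf mx mu mw; apply: measurable_funD.
  apply: measurable_sum => -[i im]; apply: measurable_stage => //= k ki.
    by apply: mu; exact: leq_ltn_trans im.
  by apply: mw; exact: ltn_trans im.
by apply: (measurableT_comp mgf); exact: random_vector_traj.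
Qed.

End measurability.
End trajectories.

(** * Adaptedness as measurability *)

Section generated_random_vectors.
Context d (Omega : measurableType d) (R : realType).

(** Reading adaptedness as measurability on [Omega] with a smaller sigma-algebra makes the closure
    lemmas for random vectors available for adapted processes. *)
Lemma random_vector_sigmaP (G : set (set Omega)) n (X : Omega -> 'cV[R]_n) :
  random_vector (X : g_sigma_algebraType G -> 'cV[R]_n)
  <-> sigma_rv X `<=` <<s G >>.
Proof.
split=> [mX _ [D mD <-]|XG _ D mD]; first exact: mX.
by apply: XG; exists D.
Qed.

Lemma random_vectorP n (X : Omega -> 'cV[R]_n) :
  random_vector X <-> sigma_rv X `<=` measurable.
Proof.
split=> [mX _ [D mD <-]|XG _ D mD]; first exact: mX.
by apply: XG; exists D.
Qed.

Lemma sigma_algebra_sigma_rv n (X : Omega -> 'cV[R]_n) :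
  sigma_algebra setT (sigma_rv X).
Proof. by apply: sigma_algebra_preimage; exact: sigma_algebra_measurable. Qed.

Lemma g_sigma_algebra_id_measurable (G : set (set Omega)) :
  <<s G >> `<=` measurable ->
  measurable_fun setT (idfun : Omega -> g_sigma_algebraType G).
Proof. by move=> mG _ D mD; rewrite setTI; exact: mG. Qed.

End generated_random_vectors.

(** * Costs averaged over the noise for fixed data *)

Section noise_trajectories.
Local Open Scope ereal_scope.
Context d (Omega : measurableType d) (R : realType) (P : probability Omega R).
Context (n l : nat) (M : 'M[R]_n) (B : 'M[R]_(n, l)) (K : 'M[R]_(l, n)).
Context (W : nat -> Omega -> 'cV[R]_n).
Hypothesis W_random : forall k, random_vector (W k).

Definition noise_traj (x : 'cV[R]_n) (u : nat -> 'cV[R]_l) (j k : nat)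
    : Omega -> 'cV[R]_n :=
  fun w => traj M B x u (fun i => W (j + i)%N w) k.

(** The data [x] and [u] are deterministic; only the noise from time [j] on is averaged. Up to
    constants this is the open-loop cost. *)
Definition frozen_cost (j : nat) (g : 'cV[R]_n * 'cV[R]_l -> R)
    (gf : 'cV[R]_n -> R) (m : nat) (x : 'cV[R]_n) (u : nat -> 'cV[R]_l)
    : \bar R :=
  \int[P]_w (path_cost M B K g gf m x u (fun i => W (j + i)%N w))%:E.

Lemma noise_traj_random x u j k : random_vector (noise_traj x u j k).
Proof.
apply: (@random_vector_traj _ _ _ M B _ Omega (fun=> x) (fun i _ => u i)
  (fun i => W (j + i)%N)) => [|i _|i _].
- exact: random_vector_cst.
- exact: random_vector_cst.
- exact: W_random.
Qed.

Lemma measurable_stage_feedback (g : 'cV[R]_n * 'cV[R]_l -> R)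
    (v : 'cV[R]_l) : continuous g ->
  measurable_fun setT ((fun y => g (y, K *m y + v)%R) : borel_vec R n -> R).
Proof.
move=> cg.
apply: measurable_fun_continuous_pair => //; first exact: measurable_id.
apply: random_vectorD; last exact: random_vector_cst.
by apply: random_vector_mulmx; exact: measurable_id.
Qed.

(** Nonnegativity allows the sum to be taken out of the integral, which gives the stagewise form
    used in [ol_cost]. *)
Lemma frozen_costE (g : 'cV[R]_n * 'cV[R]_l -> R) (gf : 'cV[R]_n -> R) j m x u :
  continuous g -> measurable_fun setT (gf : borel_vec R n -> R) ->
  (forall y, (0 <= g y)%R) -> (forall y, (0 <= gf y)%R) ->
  frozen_cost j g gf m x u =
  \sum_(k < m) (\int[P]_w (g (noise_traj x u j k w,
                              K *m noise_traj x u j k w + u k)%R)%:E)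
  + \int[P]_w (gf (noise_traj x u j m w))%:E.
Proof.
move=> cg mgf g0 gf0.
have mg k : measurable_fun setT (fun w =>
    (g (noise_traj x u j k w, K *m noise_traj x u j k w + u k)%R)%:E).
  apply/measurable_EFinP.
  apply: (measurableT_comp (measurable_stage_feedback (u k) cg)).
  exact: noise_traj_random.
rewrite -ge0_integral_sum//; last by move=> k w _; rewrite lee_fin.
rewrite -ge0_integralD//; last 4 first.
- by move=> w _; apply: sume_ge0 => k _; rewrite lee_fin.
- exact: emeasurable_sum.
- by move=> w _; rewrite lee_fin.
- apply/measurable_EFinP; apply: (measurableT_comp mgf).
  exact: noise_traj_random.
by apply: eq_integral => w _; rewrite /path_cost EFinD sumEFin.
Qed.

End noise_trajectories.

(** * Freezing and time invariance, where [G k] generates the information at time [k] *)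

Section adapted_noise.
Local Open Scope ereal_scope.
Context d (Omega : measurableType d) (R : realType) (P : probability Omega R).
Context (n l : nat) (M : 'M[R]_n) (B : 'M[R]_(n, l)) (K : 'M[R]_(l, n)).
Context (W : nat -> Omega -> 'cV[R]_n) (G : nat -> set (set Omega)).
Hypothesis G_measurable : forall k, <<s G k >> `<=` measurable.
Hypothesis G_nondecreasing : forall k, <<s G k >> `<=` <<s G k.+1 >>.
Hypothesis W_adapted : forall k, sigma_rv (W k) `<=` <<s G k.+1 >>.
Hypothesis W_indep :
  forall k, independent_systems P (sigma_rv (W k)) <<s G k >>.

Lemma noise_random k : random_vector (W k).
Proof. by apply/random_vectorP => D /W_adapted; exact: G_measurable. Qed.

Section freezing.
Variables (g : 'cV[R]_n * 'cV[R]_l -> R) (gf : 'cV[R]_n -> R).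
Hypothesis g_continuous : continuous g.
Hypothesis gf_measurable : measurable_fun setT (gf : borel_vec R n -> R).
Hypothesis g_ge0 : forall y, (0 <= g y)%R.
Hypothesis gf_ge0 : forall y, (0 <= gf y)%R.
Variables (j m : nat) (x : Omega -> 'cV[R]_n) (u : nat -> Omega -> 'cV[R]_l).
Hypothesis x_measurable :
  random_vector (x : g_sigma_algebraType (G j) -> 'cV[R]_n).
Hypothesis u_measurable : forall i, (i < m)%N ->
  random_vector (u i : g_sigma_algebraType (G j) -> 'cV[R]_l).

Let window : set (set Omega) := \bigcup_(i in `I_m) sigma_rv (W (j + i)%N).
Let past := g_sigma_algebraType (G j).
Let future := g_sigma_algebraType window.

(** The outcome is doubled: the data read the copy that carries the past, the noise reads the copy
    that carries the window. On the diagonal this is the actual path cost. *)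
Let h (p : past * future) : \bar R :=
  (path_cost M B K g gf m (x p.1) (u^~ p.1) (fun i => W (j + i)%N p.2))%:E.

Let window_measurable : <<s window >> `<=` measurable.
Proof.
apply: smallest_sub; first exact: sigma_algebra_measurable.
by move=> D [i _]; exact: (iffLR (random_vectorP _) (noise_random _)).
Qed.

Let mpast : measurable_fun setT (idfun : Omega -> past).
Proof. exact: g_sigma_algebra_id_measurable. Qed.

Let mfuture : measurable_fun setT (idfun : Omega -> future).
Proof. exact: g_sigma_algebra_id_measurable. Qed.

Let mh : measurable_fun setT h.
Proof.
apply/measurable_EFinP.
apply: (@measurable_path_cost R n l M B K _ (past * future)%type (x \o fst)
  (fun i => u i \o fst) (fun i => W (j + i)%N \o snd)) => //.
- exact: (random_vector_comp measurable_fst).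
- move=> i im; apply: (random_vector_comp measurable_fst); exact: u_measurable.
- move=> i im; apply: (random_vector_comp measurable_snd).
  apply/random_vector_sigmaP => D WD.
  by apply: sub_sigma_algebra; exists i.
Qed.

Let h_ge0 p : 0 <= h p.
Proof. by rewrite lee_fin path_cost_ge0. Qed.

Lemma measurable_frozen_cost :
  measurable_fun setT (fun w => frozen_cost P M B K W j g gf m (x w) (u^~ w)).
Proof.
exact: (measurableT_comp (measurable_fun_integral_law P mfuture mh h_ge0) mpast).
Qed.

(** The identity maps of [Omega] into [past] and [future] are independent by [independent_windows],
    so the integral of [h] over the diagonal equals the iterated one. *)
Lemma integral_frozen_cost :
  \int[P]_w frozen_cost P M B K W j g gf m (x w) (u^~ w)
  = \int[P]_w
      (path_cost M B K g gf m (x w) (u^~ w) (fun i => W (j + i)%N w))%:E.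
Proof.
apply/esym; apply: (independent_pair_integral mpast mfuture _ mh h_ge0).
move=> A D mA mD; apply: (@independent_windows _ _ _ P (fun k => <<s G k >>)
  (fun k => sigma_rv (W k)) j _ _ _ _ _ _ m A D mA mD) => //.
by move=> k; exact: sigma_algebra_sigma_rv.
Qed.

Lemma measurable_path_cost_noise : measurable_fun setT (fun w =>
  path_cost M B K g gf m (x w) (u^~ w) (fun i => W (j + i)%N w)).
Proof.
apply: measurable_path_cost => //.
- exact: (random_vector_comp mpast).
- by move=> i im; apply: (random_vector_comp mpast); exact: u_measurable.
- by move=> i im; exact: noise_random.
Qed.

End freezing.

Section time_invariance.
Hypothesis W_law : forall k,
  same_law P (W k : Omega -> borel_vec R n) (W 0%N).
Variables (x : 'cV[R]_n) (u : nat -> 'cV[R]_l).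

Let past_le k i : <<s G k >> `<=` <<s G (k + i)%N >>.
Proof.
elim: i => [|i IH]; first by rewrite addn0.
by rewrite addnS => D /IH; exact: G_nondecreasing.
Qed.

Lemma noise_traj_adapted j k : sigma_rv (noise_traj M B W x u j k) `<=` <<s G (j + k)%N >>.
Proof.
apply/random_vector_sigmaP.
apply: (@random_vector_traj _ _ _ M B _ (g_sigma_algebraType (G (j + k)%N))
  (fun=> x) (fun i _ => u i) (fun i => W (j + i)%N)).
- exact: random_vector_cst.
- by move=> i _; exact: random_vector_cst.
- move=> i ik; apply/random_vector_sigmaP => D /W_adapted.
  by rewrite -addnS -(subnKC ik) addnA; exact: past_le.
Qed.

Lemma noise_traj_indep j k :
  independent_systems P (sigma_rv (noise_traj M B W x u j k)) (sigma_rv (W (j + k)%N)).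
Proof.
move=> A D /noise_traj_adapted GA WD.
by rewrite setIC (W_indep WD GA) muleC.
Qed.

(** By induction on [k]: the state at step [k] is independent of the next noise, so the law of the
    next state depends only on the two marginal laws, neither of which depends on [j]. *)
Lemma noise_traj_law j k :
  same_law P (noise_traj M B W x u j k : Omega -> borel_vec R n) (noise_traj M B W x u 0 k).
Proof.
elim: k => [|k IH] //.
have indep i : independent_pair P (noise_traj M B W x u i k : Omega -> borel_vec R n)
    (W (i + k)%N : Omega -> borel_vec R n).
  move=> A D mA mD; apply: noise_traj_indep.
    by exists A => //; rewrite setTI.
  by exists D => //; rewrite setTI.
pose f (p : borel_vec R n * borel_vec R n) : borel_vec R n :=
  (M *m (p.1 : 'cV[R]_n) + B *m u k + (p.2 : 'cV[R]_n))%R.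
apply: (@independent_pair_same_law _ _ _ P _ (borel_vec R n) _ (borel_vec R n)
  _ (borel_vec R n) (noise_traj M B W x u j k) (noise_traj M B W x u 0 k) (W (j + k)%N)
  (W (0 + k)%N) f) => //; try exact: (noise_traj_random _ _ noise_random); try exact: noise_random.
- apply: (@random_vectorD _ _ R n); last exact: measurable_snd.
  apply: random_vectorD; last exact: random_vector_cst.
  by apply: random_vector_mulmx; exact: measurable_fst.
- by move=> D mD; rewrite !W_law.
Qed.

End time_invariance.

Section descent.
Hypothesis W_law : forall k,
  same_law P (W k : Omega -> borel_vec R n) (W 0%N).
Variables (g : 'cV[R]_n * 'cV[R]_l -> R) (gf : 'cV[R]_n -> R).
Hypothesis g_continuous : continuous g.
Hypothesis gf_measurable : measurable_fun setT (gf : borel_vec R n -> R).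
Hypothesis g_ge0 : forall y, (0 <= g y)%R.
Hypothesis gf_ge0 : forall y, (0 <= gf y)%R.

(* The noise is i.i.d., so both sides may be evaluated at j = 0, where the
   state at time m is independent of W m. *)
Lemma frozen_cost_descent (m : nat) (vf : 'cV[R]_l) (s : \bar R) :
  (forall X : Omega -> 'cV[R]_n, random_vector X ->
     independent_systems P (sigma_rv X) (sigma_rv (W m)) ->
     \int[P]_w (gf (M *m X w + B *m vf + W m w)%R)%:E
     + \int[P]_w (g (X w, K *m X w + vf)%R)%:E
     <= \int[P]_w (gf (X w))%:E + s) ->
  forall j x u, u m = vf ->
  frozen_cost P M B K W j g gf m.+1 x u <= frozen_cost P M B K W j g gf m x u + s.
Proof.
move=> decr j x u um; move: decr; rewrite -{vf}um => decr.
(* The first [m] stage terms are common to both sides; what remains is the last stage and the two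
   terminal terms. *)
rewrite !(frozen_costE _ _ _ _ noise_random)// big_ord_recr /= -[leLHS]addeA -[leRHS]addeA leeD2l//.
have gflaw k : \int[P]_w (gf (noise_traj M B W x u j k w))%:E
    = \int[P]_w (gf (noise_traj M B W x u 0 k w))%:E.
  apply: (@same_law_integral _ _ _ P _ (borel_vec R n) _ _
    (fun y => (gf y)%:E)).
  - exact: (noise_traj_random _ _ noise_random).
  - exact: (noise_traj_random _ _ noise_random).
  - exact: noise_traj_law.
  - exact/measurable_EFinP.
  - by move=> y; rewrite lee_fin.
have glaw : \int[P]_w (g (noise_traj M B W x u j m w,
      K *m noise_traj M B W x u j m w + u m)%R)%:E
    = \int[P]_w (g (noise_traj M B W x u 0 m w,
      K *m noise_traj M B W x u 0 m w + u m)%R)%:E.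
  apply: (@same_law_integral _ _ _ P _ (borel_vec R n) _ _
    (fun y => (g (y, K *m y + u m)%R)%:E)).
  - exact: (noise_traj_random _ _ noise_random).
  - exact: (noise_traj_random _ _ noise_random).
  - exact: noise_traj_law.
  - apply/measurable_EFinP; exact: measurable_stage_feedback.
  - by move=> y; rewrite lee_fin.
rewrite !gflaw glaw addeC; apply: (decr (noise_traj M B W x u 0 m)).
  exact: (noise_traj_random _ _ noise_random).
exact: noise_traj_indep.
Qed.

End descent.
End adapted_noise.

(** * Constants, averages and telescoping in the extended reals *)

Section extended_real_bounds.
Local Open Scope ereal_scope.

(** If [h] has finite integral this is linearity. Otherwise the positive part of [h - c] still has
    infinite integral while its negative part is at most [c], so no difference of infinities
    arises. *)
Lemma integral_ge0_subC d (T : measurableType d) (R : realType)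
    (P : probability T R) (h : T -> \bar R) (c : R) :
  measurable_fun setT h -> (forall t, 0 <= h t) -> (0 <= c)%R ->
  \int[P]_t (h t - c%:E) = \int[P]_t h t - c%:E.
Proof.
move=> mh h0 c0.
have intc : \int[P]_t c%:E = c%:E.
  by rewrite integral_cst//= probability_setT mule1.
have [hoo|] := ltP (\int[P]_t h t) +oo.
  have ih : P.-integrable setT h.
    apply/integrableP; split => //.
    by under eq_integral do rewrite gee0_abs//.
  have ic : P.-integrable setT (cst c%:E).
    exact: finite_measure_integrable_cst.
  by rewrite (integralB measurableT ih ic) intc.
rewrite leye_eq => /eqP hoo; rewrite hoo addye//.
pose f t := h t - c%:E.
have mf : measurable_fun setT f by apply: emeasurable_funB.
have fp0 t : 0 <= f^\+ t by exact: funepos_ge0.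
have hle t : h t <= f^\+ t + c%:E.
  by rewrite -leeBlDr// funeposE le_max lexx.
have fpoo : \int[P]_t f^\+ t = +oo.
  apply/eqP; rewrite -leye_eq.
  have : \int[P]_t h t <= \int[P]_t (f^\+ t + c%:E).
    apply: ge0_le_integral => //.
    by apply: emeasurable_funD => //; exact: measurable_funepos.
  rewrite ge0_integralD//; last exact: measurable_funepos.
  rewrite intc hoo.
  by case: (\int[P]_t f^\+ t).
have fn : \int[P]_t f^\- t <= c%:E.
  rewrite -intc; apply: ge0_le_integral => //; first exact: measurable_funeneg.
  move=> t _; rewrite funenegE /f ge_max lee_fin c0 andbT.
  by rewrite leeNl leeBrDr// -EFinN -EFinD addNr h0.
rewrite integralE fpoo.
by move: fn; case: (\int[P]_t f^\- t).
Qed.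

(** The average is at most [S + C / L], and [C / L] falls below any positive [e]. *)
Lemma limn_esup_average_le (R : realType) (a : nat -> \bar R) (C S : R) :
  (forall L, \sum_(0 <= k < L) a k <= (C + L%:R * S)%:E) ->
  limn_esup (fun L => (L%:R^-1)%:E * \sum_(0 <= k < L) a k) <= S%:E.
Proof.
move=> aCS; apply/lee_addgt0Pr => e e0.
have [L0 _ CL] : \forall L \near \oo, (C < L%:R * e)%R.
  near=> L; rewrite -ltr_pdivrMr//; near: L.
  exact: nbhs_infty_gtr.
apply: le_trans.
  (* The limsup is at most the supremum over one tail; starting it at [L0.+1] keeps [L] positive for
     the division. *)
  apply: ereal_inf_lbound; exists [set L | (L0.+1 <= L)%N] => //=.
  by exists L0.+1.
apply: ge_ereal_sup => _ [L /= LL0 <-].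
have L_gt0 : (0 < L%:R :> R)%R by rewrite ltr0n (leq_ltn_trans _ LL0).
rewrite muleC lee_pdivrMr// (le_trans (aCS L))// lee_fin.
have := CL L (ltnW LL0); rewrite /= => /ltW CLe.
by rewrite mulrDl [(S * _)%R]mulrC [(e * _)%R]mulrC addrC lerD2l.
Unshelve. all: by end_near. Qed.

(** [J L] stays on the left instead of being subtracted, since it may be infinite. *)
Lemma telescoping_sum_le (R : realType) (J l : nat -> \bar R) (s : R) :
  (forall j, J j.+1 + l j <= J j + s%:E) ->
  forall L, \sum_(0 <= k < L) l k + J L <= J 0%N + (L%:R * s)%:E.
Proof.
move=> Jl; elim=> [|L IH]; first by rewrite big_nil add0e mul0r adde0.
rewrite big_nat_recr// -addeA [l L + _]addeC.
apply: (le_trans (leeD2l _ (Jl L))).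
by rewrite addeA (le_trans (leeD2r s%:E IH))// -addeA -EFinD -natr1 mulrDl mul1r.
Qed.

End extended_real_bounds.

(** * Closed loop *)

Lemma mean_same_law d (Omega : measurableType d) (R : realType)
    (P : probability Omega R) n (X Y : Omega -> 'cV[R]_n) :
  random_vector X -> random_vector Y ->
  same_law P (X : Omega -> borel_vec R n) Y -> mean P X = mean P Y.
Proof.
move=> mX mY XY; apply/colP => i; rewrite !mxE; congr fine.
rewrite unlock; apply: (same_law_integral_signed mX mY XY
  (h := fun y : borel_vec R n => ((y : 'cV[R]_n) i 0)%:E)).
apply/measurable_EFinP.
by apply: (@random_vector_coord _ (borel_vec R n) R n idfun); exact: measurable_id.
Qed.

Section closed_loop_adapted.
Context d (Omega : measurableType d) (R : realType) (n l : nat).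
Context (A : 'M[R]_n) (B : 'M[R]_(n, l)) (K : 'M[R]_(l, n)).
Context (W : nat -> Omega -> 'cV[R]_n) (X0 : Omega -> 'cV[R]_n).
Context (N : nat) (vs : nat -> Omega -> N.-tuple 'cV[R]_l).
Hypothesis N_gt0 : (0 < N)%N.
Hypothesis X0_random : random_vector X0.
Hypothesis W_random : forall k, random_vector (W k).

Local Notation X := (cl_state A B W K vs X0).
Local Notation U := (cl_input A B W K vs X0).

Hypothesis vs_adapted : forall j (k : 'I_N),
  sigma_rv (fun w => (vs j w)`_k) `<=` natural_filtration X j.

(** Names the generators of the filtration: [<<s state_events k >>] unfolds to
    [natural_filtration X k]. *)
Definition state_events (k : nat) : set (set Omega) :=
  \bigcup_(i in `I_k.+1) sigma_rv (X i).

Lemma state_events_nondecreasing k :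
  <<s state_events k >> `<=` <<s state_events k.+1 >>.
Proof.
apply: sub_sigma_algebra2 => D [i /= ik XD]; exists i => //=.
exact: leqW.
Qed.

Lemma cl_state_adapted k : sigma_rv (X k) `<=` <<s state_events k >>.
Proof. by move=> D XD; apply: sub_sigma_algebra; exists k => /=. Qed.

Lemma cl_input_adapted k : sigma_rv (U k) `<=` <<s state_events k >>.
Proof.
apply/random_vector_sigmaP; apply: random_vectorD.
  by apply: random_vector_mulmx; apply/random_vector_sigmaP; exact: cl_state_adapted.
by apply/random_vector_sigmaP; exact: (@vs_adapted k (Ordinal N_gt0)).
Qed.

(** The system equation solved for the noise: the next state, the state and the input reveal it. *)
Lemma noise_adapted k : sigma_rv (W k) `<=` <<s state_events k.+1 >>.
Proof.
apply/random_vector_sigmaP.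
have -> : W k = (fun w => X k.+1 w + - (A *m X k w + B *m U k w)).
  by apply/funext => w /=; rewrite addrC addKr.
apply: random_vectorD; first by apply/random_vector_sigmaP; exact: cl_state_adapted.
apply: random_vectorN; apply: random_vectorD; apply: random_vector_mulmx.
  apply/random_vector_sigmaP => D /cl_state_adapted.
  exact: state_events_nondecreasing.
apply/random_vector_sigmaP => D /cl_input_adapted.
exact: state_events_nondecreasing.
Qed.

(** Inputs are only known to be adapted, so the induction alternates: measurable states up to [k]
    make the input at [k] measurable, hence the state at [k + 1]. *)
Lemma state_events_measurable k : <<s state_events k >> `<=` measurable.
Proof.
elim: k => [|k IH]; apply: smallest_sub.
- exact: sigma_algebra_measurable.
- move=> D [i /=]; rewrite ltnS leqn0 => /eqP ->.
  exact: (iffLR (random_vectorP _) X0_random).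
- exact: sigma_algebra_measurable.
- move=> D [i /=]; rewrite ltnS leq_eqVlt => /predU1P[->|ik] XD; last first.
    by apply: IH; apply: sub_sigma_algebra; exists i.
  have rv m (Y : Omega -> 'cV[R]_m) : sigma_rv Y `<=` <<s state_events k >> ->
      random_vector Y.
    by move=> YG; apply/random_vectorP => E /YG; exact: IH.
  suff /random_vectorP : random_vector (X k.+1) by exact.
  apply: random_vectorD; last exact: W_random.
  apply: random_vectorD; apply: random_vector_mulmx; apply: rv.
    exact: cl_state_adapted.
  exact: cl_input_adapted.
Qed.

End closed_loop_adapted.

(** * The shifted candidate and recursive feasibility *)

Section candidate.
Context d (Omega : measurableType d) (R : realType) (P : probability Omega R).
Context (n l : nat) (A : 'M[R]_n) (B : 'M[R]_(n, l)) (K : 'M[R]_(l, n)).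
Context (W : nat -> Omega -> 'cV[R]_n) (N : nat).
Implicit Types (v : N.-tuple 'cV[R]_l) (j k : nat).

(** An infinite sequence, so that the candidate is its shift by one and the nominal trajectories at
    times [j] and [j + 1] are windows of a single [traj]. *)
Definition extended_input v (vf : 'cV[R]_l) (k : nat) : 'cV[R]_l :=
  if (k < N)%N then v`_k else vf.

Definition candidate v (vf : 'cV[R]_l) : N.-tuple 'cV[R]_l :=
  [tuple extended_input v vf i.+1 | i < N].

Lemma nth_candidate v vf k : (k < N)%N ->
  (candidate v vf)`_k = extended_input v vf k.+1.
Proof.
by move=> kN; rewrite -[k]/(nat_of_ord (Ordinal kN)) -tnth_nth tnth_mktuple.
Qed.

Lemma ol_stateE j x v k w : ol_state A B W K j x v k w
  = traj (A + B *m K) B x (fun i => v`_i) (fun i => W (j + i)%N w) k.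
Proof. by elim: k => //= k ->. Qed.

Lemma ol_nominalE j z v k : ol_nominal P A B W K j z v k
  = traj (A + B *m K) B z (fun i => v`_i) (fun i => mean P (W (j + i)%N)) k.
Proof. by elim: k => //= k ->. Qed.

(** Errors do not depend on the inputs, so the prediction is the true error; the tightening at stage
    [k] of time [j + 1] is that at stage [k + 1] of time [j]. *)
Lemma ol_errorE X0 j k :
  ol_error P A B W K j (error P A B W K X0 j) k = error P A B W K X0 (j + k).
Proof. by elim: k => [|k IH] /=; rewrite ?addn0// addnS /= IH. Qed.

Lemma ol_nominal_candidate j z v vf k : (0 < N)%N -> (k <= N)%N ->
  ol_nominal P A B W K j.+1
    (closed_gain A B K *m z + B *m v`_0 + mean P (W j)) (candidate v vf) k
  = traj (A + B *m K) B z (extended_input v vf)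
      (fun i => mean P (W (j + i)%N)) k.+1.
Proof.
move=> N0 kN; rewrite ol_nominalE traj_shift /= addn0 {2}/extended_input N0.
apply: eq_traj => i ik; first by rewrite nth_candidate// (leq_trans ik).
by rewrite addSnnS.
Qed.

Lemma ol_nominal_extended j z v vf k : (k <= N)%N ->
  traj (A + B *m K) B z (extended_input v vf) (fun i => mean P (W (j + i)%N)) k
  = ol_nominal P A B W K j z v k.
Proof.
move=> kN; rewrite ol_nominalE; apply: eq_traj => // i ik.
by rewrite /extended_input (leq_trans ik).
Qed.

Context (mx mu : nat) (c : 'I_mx -> 'cV[R]_n) (p : 'I_mx -> R).
Context (e : 'I_mu -> 'cV[R]_l) (q : 'I_mu -> R).
Context (rho : (Omega -> R) -> \bar R) (X0 : Omega -> 'cV[R]_n).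
Context (V : set 'cV[R]_l) (Zf : set 'cV[R]_n) (vf : 'cV[R]_l).
Hypothesis N_gt0 : (0 < N)%N.
Hypothesis W_mean : forall k, mean P (W k) = mean P (W 0%N).
Hypothesis Zf_state : forall z, Zf z -> forall i : 'I_mx,
  ((dot (c i) z)%:E <= (p i)%:E
     - ereal_sup (range (fun j : nat =>
         rho (fun w => dot (c i) (error P A B W K X0 j w)))))%E.
Hypothesis vf_V : V vf.
Hypothesis vf_invariant : forall z, Zf z ->
  Zf ((A + B *m K) *m z + B *m vf + mean P (W 0%N)).
Hypothesis vf_input : forall z, Zf z -> forall i : 'I_mu,
  ((dot (e i) (K *m z + vf)%R)%:E <= (q i)%:E
     - ereal_sup (range (fun j : nat =>
         rho (fun w => dot (e i) (K *m error P A B W K X0 j w)))))%E.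

(** All stages but the last inherit their constraints from the following stage at time [j]. At the
    last one the nominal state lies in [Zf], where the bounds hold with the supremum over all
    errors. *)
Lemma candidate_admissible j z v :
  ol_admissible P A B W c p e q rho K j V Zf z (error P A B W K X0 j) v ->
  ol_admissible P A B W c p e q rho K j.+1 V Zf
    (closed_gain A B K *m z + B *m v`_0 + mean P (W j))
    (error P A B W K X0 j.+1) (candidate v vf).
Proof.
move=> [vV zN cz ez].
have sub_sup (f : nat -> \bar R) (r : R) i :
    (r%:E - ereal_sup (range f) <= r%:E - f i)%E.
  by apply: leeB => //; apply: ereal_sup_ubound; exists i.
split.
- move=> k; rewrite nth_candidate// /extended_input.
  by case: ifPn => // kN; exact: (vV (Ordinal kN)).
(* The final step applies [vf] to the old terminal state, hence the invariance of [Zf]. *)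
- rewrite ol_nominal_candidate//= ol_nominal_extended// /extended_input ltnn.
  by rewrite W_mean; exact: vf_invariant.
- move=> k i; rewrite ol_errorE ol_nominal_candidate; [|by []|exact: ltnW].
  rewrite ol_nominal_extended// addSnnS.
  have [kN|] := ltnP k.+1 N.
    by have := cz (Ordinal kN) i; rewrite ol_errorE.
  move=> Nk; have -> : k.+1 = N by apply/eqP; rewrite eqn_leq Nk ltn_ord.
  apply: (le_trans (Zf_state zN i)).
  exact: (sub_sup (fun j => rho (fun w => dot (c i) (error P A B W K X0 j w)))).
- move=> k i; rewrite ol_errorE ol_nominal_candidate; [|by []|exact: ltnW].
  rewrite ol_nominal_extended// addSnnS nth_candidate// /extended_input.
  have [kN|] := ltnP k.+1 N.
    by have := ez (Ordinal kN) i; rewrite ol_errorE.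
  move=> Nk; have -> : k.+1 = N by apply/eqP; rewrite eqn_leq Nk ltn_ord.
  apply: (le_trans (vf_input zN i)).
  exact: (sub_sup (fun j => rho (fun w => dot (e i) (K *m error P A B W K X0 j w)))).
Qed.

End candidate.

(** * Reduction to nonnegative costs *)

Section cost_shift.
Context d (Omega : measurableType d) (R : realType) (P : probability Omega R).
Context (n l : nat).
Variables (g : 'cV[R]_n * 'cV[R]_l -> R) (gf : 'cV[R]_n -> R) (b bf : R).
Hypothesis g_continuous : continuous g.
Hypothesis gf_measurable : measurable_fun setT (gf : borel_vec R n -> R).
Hypothesis b_ge0 : 0 <= b.
Hypothesis bf_ge0 : 0 <= bf.
Hypothesis gb_ge0 : forall y, 0 <= g y + b.
Hypothesis gfb_ge0 : forall y, 0 <= gf y + bf.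

Lemma stage_cost_shift (X : Omega -> 'cV[R]_n) (U : Omega -> 'cV[R]_l) :
  random_vector X -> random_vector U ->
  stage_cost P g X U
  = ((\int[P]_w (g (X w, U w) + b)%:E) - b%:E)%E.
Proof.
move=> mX mU; rewrite /stage_cost unlock -integral_ge0_subC//.
- by apply: eq_integral => w _; rewrite -EFinB addrK.
- apply/measurable_EFinP; apply: measurable_funD => //.
  exact: measurable_fun_continuous_pair.
- by move=> w; rewrite lee_fin.
Qed.

Lemma terminal_cost_shift (X : Omega -> 'cV[R]_n) : random_vector X ->
  terminal_cost P gf X = ((\int[P]_w (gf (X w) + bf)%:E) - bf%:E)%E.
Proof.
move=> mX; rewrite /terminal_cost unlock -integral_ge0_subC//.
- by apply: eq_integral => w _; rewrite -EFinB addrK.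
- apply/measurable_EFinP; apply: measurable_funD => //.
  exact: (measurableT_comp gf_measurable).
- by move=> w; rewrite lee_fin.
Qed.

End cost_shift.

(** * Descent of the expected optimal cost along the closed loop *)

Section mpc_performance.
Local Open Scope ereal_scope.
Context d (Omega : measurableType d) (R : realType) (P : probability Omega R).
Context (n l : nat) (A : 'M[R]_n) (B : 'M[R]_(n, l)) (K : 'M[R]_(l, n)).
Context (W : nat -> Omega -> 'cV[R]_n) (X0 : Omega -> 'cV[R]_n).
Context (N : nat) (vs : nat -> Omega -> N.-tuple 'cV[R]_l) (vf : 'cV[R]_l).
Hypothesis N_gt0 : (0 < N)%N.
Hypothesis X0_random : random_vector X0.
Hypothesis W_random : forall k, random_vector (W k).
Hypothesis W_law : forall k,
  same_law P (W k : Omega -> borel_vec R n) (W 0%N).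
Hypothesis W_independent : noise_independent P A B W X0.

Local Notation M := (A + B *m K)%R.
Local Notation X := (cl_state A B W K vs X0).
Local Notation U := (cl_input A B W K vs X0).
Local Notation G := (state_events A B K W X0 vs).

Hypothesis vs_adapted : forall j (k : 'I_N),
  sigma_rv (fun w => (vs j w)`_k) `<=` natural_filtration X j.

Let mG k : <<s G k >> `<=` measurable.
Proof. exact: state_events_measurable. Qed.

Let WG k : sigma_rv (W k) `<=` <<s G k.+1 >>.
Proof. exact: noise_adapted. Qed.

Let GS k : <<s G k >> `<=` <<s G k.+1 >>.
Proof. exact: state_events_nondecreasing. Qed.

(** The closed loop is itself an adapted trajectory, so the independence assumption on the noise
    applies to it. *)
Let WI k : independent_systems P (sigma_rv (W k)) <<s G k >>.
Proof.
apply: (W_independent (X := X) (U := U)) => //.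
by move=> j; exact: cl_input_adapted.
Qed.

Lemma cl_state_random k : random_vector (X k).
Proof. by apply/random_vectorP => D /cl_state_adapted; exact: mG. Qed.

Lemma cl_input_random k : random_vector (U k).
Proof.
apply/random_vectorP => D /(cl_input_adapted N_gt0 vs_adapted).
exact: mG.
Qed.

Section descent.
Variables (g : 'cV[R]_n * 'cV[R]_l -> R) (gf : 'cV[R]_n -> R) (s : R).
Hypothesis g_continuous : continuous g.
Hypothesis gf_measurable : measurable_fun setT (gf : borel_vec R n -> R).
Hypothesis g_ge0 : forall y, (0 <= g y)%R.
Hypothesis gf_ge0 : forall y, (0 <= gf y)%R.
Hypothesis s_ge0 : (0 <= s)%R.

Local Notation cost j := (frozen_cost P M B K W j g gf).

Hypothesis terminal_decrease : forall Y : Omega -> 'cV[R]_n, random_vector Y ->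
  independent_systems P (sigma_rv Y) (sigma_rv (W N)) ->
  \int[P]_w (gf (M *m Y w + B *m vf + W N w)%R)%:E
  + \int[P]_w (g (Y w, K *m Y w + vf)%R)%:E
  <= \int[P]_w (gf (Y w))%:E + s%:E.
Hypothesis candidate_cost : forall j w,
  cost j.+1 N (X j.+1 w) (fun i => (vs j.+1 w)`_i)
  <= cost j.+1 N (X j.+1 w) (fun i => (candidate (vs j w) vf)`_i).

Let u j w := extended_input (vs j w) vf.

Let u_adapted j i :
  random_vector ((fun w => u j w i) : g_sigma_algebraType (G j) -> 'cV[R]_l).
Proof.
rewrite /u /extended_input; have [iN|_] := ltnP i N; last first.
  exact: random_vector_cst.
by apply/random_vector_sigmaP; exact: (@vs_adapted j (Ordinal iN)).
Qed.

Let X_adapted j : random_vector (X j : g_sigma_algebraType (G j) -> 'cV[R]_n).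
Proof. by apply/random_vector_sigmaP; exact: cl_state_adapted. Qed.

Let vs_random j i : (i < N)%N ->
  random_vector ((fun w => (vs j w)`_i) : g_sigma_algebraType (G j) -> 'cV[R]_l).
Proof.
by move=> iN; apply/random_vector_sigmaP; exact: (@vs_adapted j (Ordinal iN)).
Qed.

Let measurable_cost j m (x : Omega -> 'cV[R]_n) (v : nat -> Omega -> 'cV[R]_l) :
  random_vector (x : g_sigma_algebraType (G j) -> 'cV[R]_n) ->
  (forall i, (i < m)%N ->
    random_vector (v i : g_sigma_algebraType (G j) -> 'cV[R]_l)) ->
  measurable_fun setT (fun w => cost j m (x w) (v^~ w)).
Proof. by move=> mx mv; exact: measurable_frozen_cost. Qed.

Let cost_ge0 j m x v : 0 <= cost j m x v.
Proof. by apply: integral_ge0 => w _; rewrite lee_fin path_cost_ge0. Qed.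

Let eq_cost j m x v v' : (forall i, (i < m)%N -> v i = v' i) ->
  cost j m x v = cost j m x v'.
Proof.
move=> vv'; apply: eq_integral => w _; congr EFin.
exact: eq_path_cost.
Qed.

Lemma measurable_selected_cost j : measurable_fun setT
  (fun w => cost j N (X j w) (fun i => (vs j w)`_i)).
Proof.
exact: (@measurable_cost j N (X j) (fun i w => (vs j w)`_i)
  (@X_adapted j) (@vs_random j)).
Qed.

(** Both sides are compared with the expected cost at time [j] over [N + 1] steps under the extended
    input: optimality against the candidate bounds the left side by it, the terminal decrease bounds
    it by the right side. *)
Lemma expected_cost_descent j :
  \int[P]_w cost j.+1 N (X j.+1 w) (fun i => (vs j.+1 w)`_i)
  + \int[P]_w (g (X j w, U j w))%:E
  <= \int[P]_w cost j N (X j w) (fun i => (vs j w)`_i) + s%:E.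
Proof.
have mu' i : (i < N)%N -> random_vector ((fun w => u j w i.+1)
    : g_sigma_algebraType (G j.+1) -> 'cV[R]_l).
  move=> iN; apply/random_vector_sigmaP; apply: subset_trans (@GS j).
  by apply/random_vector_sigmaP; exact: u_adapted.
(* Freezing at time [j + 1]: the inputs [u j] are known at time [j], hence also one step later. *)
have E1 : \int[P]_w cost j.+1 N (X j.+1 w) (fun i => u j w i.+1)
    = \int[P]_w (path_cost M B K g gf N (X j.+1 w) (fun i => u j w i.+1)
        (fun i => W (j.+1 + i)%N w))%:E.
  exact: (@integral_frozen_cost _ _ _ P _ _ M B K W G mG GS WG WI g gf _ _ _ _
    j.+1 N (X j.+1) (fun i w => u j w i.+1)).
have E2 : \int[P]_w cost j N.+1 (X j w) (u j w)
    = \int[P]_w (path_cost M B K g gf N.+1 (X j w) (u j w)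
        (fun i => W (j + i)%N w))%:E.
  exact: (@integral_frozen_cost _ _ _ P _ _ M B K W G mG GS WG WI g gf _ _ _ _
    j N.+1 (X j) (fun i w => u j w i)).
(* Only the first entry of the sequence is applied, so the closed loop moves along the extended
   trajectory for one step. *)
have X1 w : X j.+1 w = traj M B (X j w) (u j w) (fun i => W (j + i)%N w) 1.
  rewrite /= addn0 /u /extended_input N_gt0 mulmxDr mulmxDl mulmxA.
  by rewrite [in LHS]addrA.
have U0 w : U j w = (K *m X j w + u j w 0%N)%R.
  by rewrite /u /extended_input N_gt0.
have X_random := cl_state_random; have U_random := cl_input_random.
(* On the actual path, the stage at [j] followed by the candidate cost is the cost over [N + 1]
   steps. *)
have E3 : \int[P]_w (path_cost M B K g gf N (X j.+1 w) (fun i => u j w i.+1)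
        (fun i => W (j.+1 + i)%N w))%:E + \int[P]_w (g (X j w, U j w))%:E
    = \int[P]_w cost j N.+1 (X j w) (u j w).
  rewrite E2 -ge0_integralD//.
  - apply: eq_integral => w _; rewrite -path_cost_shift addeC EFinD -X1 -U0.
    rewrite (_ : (fun i => W (j.+1 + i)%N w) = (fun i => W (j + i.+1)%N w))//.
    by apply/funext => i; rewrite addSnnS.
  - by move=> w _; rewrite lee_fin path_cost_ge0.
  - apply/measurable_EFinP.
    exact: (@measurable_path_cost_noise _ _ _ _ _ M B K W G mG WG g gf _ _
      j.+1 N (X j.+1) (fun i w => u j w i.+1)).
  - by move=> w _; rewrite lee_fin.
  - apply/measurable_EFinP; exact: measurable_fun_continuous_pair.
apply: (@le_trans _ _ (\int[P]_w cost j N.+1 (X j w) (u j w))).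
  rewrite -E3 -E1 leeD2r//; apply: ge0_le_integral => //.
  - exact: measurable_selected_cost.
  - exact: (@measurable_cost j.+1 N (X j.+1) (fun i w => u j w i.+1)
      (@X_adapted j.+1) mu').
  - move=> w _; apply: (le_trans (candidate_cost j w)).
    rewrite (@eq_cost _ _ _ _ (fun i => u j w i.+1))// => i iN.
    by rewrite nth_candidate.
have mcost : measurable_fun setT (fun w => cost j N (X j w) (u j w)).
  exact: (@measurable_cost j N (X j) (fun i w => u j w i)
    (@X_adapted j) (fun i _ => @u_adapted j i)).
apply: (@le_trans _ _ (\int[P]_w (cost j N (X j w) (u j w) + s%:E))).
  apply: ge0_le_integral => //.
  - exact: (@measurable_cost j N.+1 (X j) (fun i w => u j w i)
    (@X_adapted j) (fun i _ => @u_adapted j i)).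
  - by apply: emeasurable_funD.
  - move=> w _; apply: frozen_cost_descent terminal_decrease _ _ _ _ => //.
    by rewrite /u /extended_input ltnn.
rewrite ge0_integralD// integral_cst//= probability_setT mule1 leeD2r//.
(* A cost over [N] steps sees only the first [N] inputs, where [u j] is the selected sequence. *)
rewrite le_eqVlt; apply/orP; left; apply/eqP; apply: eq_integral => w _.
by apply: eq_cost => i iN; rewrite /u /extended_input iN.
Qed.

End descent.
End mpc_performance.

Lemma continuous_addr (T : topologicalType) (R : realType) (f : T -> R)
  (b : R) : continuous f -> continuous (fun y => f y + b).
Proof.
by move=> cf y; apply: continuousD; [exact: cf|exact: cst_continuous].
Qed.

Lemma ol_cost_shift d (Omega : measurableType d) (R : realType)
    (P : probability Omega R) n l (A : 'M[R]_n) (B : 'M[R]_(n, l))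
    (K : 'M[R]_(l, n)) (W : nat -> Omega -> 'cV[R]_n)
    (g : 'cV[R]_n * 'cV[R]_l -> R) (gf : 'cV[R]_n -> R) (b bf : R)
    (N j : nat) (x : 'cV[R]_n) (v : N.-tuple 'cV[R]_l) :
  (forall k, random_vector (W k)) -> continuous g ->
  measurable_fun setT (gf : borel_vec R n -> R) -> 0 <= b -> 0 <= bf ->
  (forall y, 0 <= g y + b) -> (forall y, 0 <= gf y + bf) ->
  ol_cost P A B W K j g gf x v
  = (frozen_cost P (A + B *m K) B K W j (fun y => (g y + b)%R)
      (fun y => (gf y + bf)%R) N x (fun i => v`_i)
     - (N%:R * b + bf)%:E)%E.
Proof.
move=> W_random cg mgf b0 bf0 gb gfb.
have stateE k : ol_state A B W K j x v k
    = noise_traj (A + B *m K) B W x (fun i => v`_i) j k.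
  by apply/funext => w; rewrite ol_stateE.
have state_random k : random_vector
    (noise_traj (A + B *m K) B W x (fun i => v`_i) j k).
  exact: noise_traj_random.
have cgb : continuous (fun y => g y + b) by exact: continuous_addr.
have mgfb : measurable_fun setT
    ((fun y => gf y + bf) : borel_vec R n -> R).
  by apply: measurable_funD.
rewrite frozen_costE//.
rewrite /ol_cost stateE (terminal_cost_shift P mgf bf0 gfb)//.
under eq_bigr => k _.
  rewrite (stage_cost_shift P cg b0 gb)//; last 2 first.
  - by rewrite stateE.
  - rewrite /ol_input stateE; apply: random_vectorD; last exact: random_vector_cst.
    exact: random_vector_mulmx.
  rewrite /ol_input stateE.
  over.
rewrite big_split/= addeACA; congr (_ + _)%E.
by rewrite sumEFin sumr_const card_ord mulNrn -EFinD opprD mulr_natl.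
Qed.

Theorem mainTheorem4
  (d : measure_display) (Omega : measurableType d) (R : realType)
  (P : probability Omega R) (n l : nat)
  (* system *)
  (A : 'M[R]_n) (B : 'M[R]_(n, l)) (AB_controllable : controllable A B)
  (X0 : Omega -> 'cV[R]_n) (X0_random : random_vector X0)
  (X0_mean : finite_mean P X0)
  (W : nat -> Omega -> 'cV[R]_n) (W_random : forall k, random_vector (W k))
  (W_iid : iid P W) (W_mean : forall k, finite_mean P (W k))
  (W_independent : noise_independent P A B W X0)
  (* costs *)
  (g : 'cV[R]_n * 'cV[R]_l -> R) (g_continuous : continuous g)
  (g_bounded_below : exists b : R, forall x, b <= g x)
  (gf : 'cV[R]_n -> R)
  (gf_measurable : measurable_fun setT (gf : borel_vec R n -> R))
  (gf_bounded_below : exists b : R, forall x, b <= gf x)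
  (* risk-averse constraints *)
  (rho : (Omega -> R) -> \bar R) (rho_risk : risk_measure P rho)
  (mx mu : nat) (c : 'I_mx -> 'cV[R]_n) (p : 'I_mx -> R)
  (e : 'I_mu -> 'cV[R]_l) (q : 'I_mu -> R)
  (* open-loop problem *)
  (K : 'M[R]_(l, n)) (K_stabilizing : schur_stable (A + B *m K))
  (V : set 'cV[R]_l) (Zf : set 'cV[R]_n) (N : nat) (N_gt0 : (0 < N)%N)
  (* closed-loop algorithm *)
  (vs : nat -> Omega -> N.-tuple 'cV[R]_l)
  (vs_mpc : mpc_selection P A B W c p e q rho K vs g gf V Zf X0)
  (* (i) *)
  (Zf_nonempty : Zf !=set0)
  (Zf_state : forall z, Zf z -> forall i : 'I_mx,
     ((dot (c i) z)%:E <= (p i)%:E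
        - ereal_sup (range (fun j : nat =>
            rho (fun w => dot (c i) (error P A B W K X0 j w)))))%E)
  (* (ii) *)
  (vf : 'cV[R]_l) (vf_V : V vf)
  (vf_invariant : forall z, Zf z ->
     Zf ((A + B *m K) *m z + B *m vf + mean P (W 0%N)))
  (vf_input : forall z, Zf z -> forall i : 'I_mu,
     ((dot (e i) (K *m z + vf)%R)%:E <= (q i)%:E
        - ereal_sup (range (fun j : nat =>
            rho (fun w => dot (e i) (K *m error P A B W K X0 j w)))))%E)
  (* (iii) *)
  (Xs : nat -> Omega -> 'cV[R]_n) (Us : nat -> Omega -> 'cV[R]_l)
  (s_stationary : stationary_pair P A B W c p e q rho Xs Us)
  (Cf : R) (Cf_ge0 : 0 <= Cf)
  (* F X < +oo only discards X for which the right-hand side could read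
     +oo - +oo; the inequality is trivial when F X = +oo otherwise *)
  (terminal_decrease : forall X : Omega -> 'cV[R]_n, random_vector X ->
     independent_systems P (sigma_rv X) (sigma_rv (W N)) ->
     (terminal_cost P gf X < +oo)%E ->
     (terminal_cost P gf
        (fun w => (A *m X w + B *m (K *m X w + vf) + W N w)%R)
      <= terminal_cost P gf X - stage_cost P g X (fun w => (K *m X w + vf)%R)
         + stage_cost P g (Xs 0%N) (Us 0%N) + Cf%:E)%E)
  (* initial feasibility *)
  (initially_feasible :
     ol_feasible P A B W c p e q rho K N 0 V Zf (mean P X0)
       (error P A B W K X0 0))
  (* the optimal open-loop cost at time 0 has finite expectation *)
  (initially_finite :
     (\int[P]_w ol_cost P A B W K 0 g gf (X0 w) (vs 0%N w) < +oo)%E) :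
  (limn_esup (fun L : nat =>
     (L%:R^-1)%:E * \sum_(0 <= k < L)
        stage_cost P g (cl_state A B W K vs X0 k) (cl_input A B W K vs X0 k))
   <= stage_cost P g (Xs 0%N) (Us 0%N) + Cf%:E)%E.

Proof.
have [[b0 gb0] [bf0 gfb0]] := (g_bounded_below, gf_bounded_below).
(* Absolute values make the shifts nonnegative, as [integral_ge0_subC] requires. *)
pose b := `|b0|; pose bf := `|bf0|.
have b_ge0 : 0 <= b by exact: normr_ge0.
have bf_ge0 : 0 <= bf by exact: normr_ge0.
have gb y : 0 <= g y + b.
  have := gb0 y; have := ler_norm (- b0); rewrite normrN -/b; lra.
have gfb y : 0 <= gf y + bf.
  have := gfb0 y; have := ler_norm (- bf0); rewrite normrN -/bf; lra.
pose g' : 'cV[R]_n * 'cV[R]_l -> R := fun y => g y + b.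
pose gf' : 'cV[R]_n -> R := fun y => gf y + bf.
have cg' : continuous g' by exact: continuous_addr.
have mgf' : measurable_fun setT (gf' : borel_vec R n -> R).
  by apply: measurable_funD.
have [W_mutual W_law] := W_iid; have [vs_optimal vs_adapted] := vs_mpc.
have W_means k : mean P (W k) = mean P (W 0%N) by apply: mean_same_law => //; exact: W_law.
pose M := A + B *m K.
pose X := cl_state A B W K vs X0; pose U := cl_input A B W K vs X0.
pose cost j w v := frozen_cost P M B K W j g' gf' N (X j w) v.
pose S := (\int[P]_w (g' (Xs 0%N w, Us 0%N w))%:E)%E.
have S0 : (0 <= S)%E.
  by apply: integral_ge0 => w _; rewrite lee_fin; exact: gb.
have Sshift : stage_cost P g (Xs 0%N) (Us 0%N) = (S - b%:E)%E.
  apply: stage_cost_shift => //; first exact: stat_random_state s_stationary 0%N.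
  exact: stat_random_input s_stationary 0%N.
(* With an infinite stationary cost the bound is trivial; afterwards it is the real number [Sr]. *)
case ES : S S0 => [Sr| |] // S0; last first.
  by rewrite Sshift ES; exact: leey.
rewrite lee_fin in S0.
have s0 : 0 <= Sr + Cf by exact: addr_ge0.
(* The terminal decrease without subtraction: the shifts [b] and [bf] cancel. When the right side is
   finite, an infinite stage cost or next terminal cost would contradict the assumed inequality. *)
have decr (Y : Omega -> 'cV[R]_n) : random_vector Y ->
    independent_systems P (sigma_rv Y) (sigma_rv (W N)) ->
    (\int[P]_w (gf' (M *m Y w + B *m vf + W N w)%R)%:E
     + \int[P]_w (g' (Y w, K *m Y w + vf)%R)%:E
     <= \int[P]_w (gf' (Y w))%:E + (Sr + Cf)%:E)%E.
  move=> mY YW.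
  have [Yoo|] := ltP (\int[P]_w (gf' (Y w))%:E)%E +oo%E; last first.
    by rewrite leye_eq => /eqP ->; rewrite addye// leey.
  have mKY : random_vector (fun w => K *m Y w + vf).
    by apply: random_vectorD; [exact: random_vector_mulmx|exact: random_vector_cst].
  have next : (fun w => A *m Y w + B *m (K *m Y w + vf) + W N w)
      = (fun w => M *m Y w + B *m vf + W N w).
    by apply/funext => w; rewrite mulmxDr mulmxDl mulmxA addrA.
  have mnext : random_vector (fun w => M *m Y w + B *m vf + W N w).
    apply: random_vectorD => //; apply: random_vectorD.
      exact: random_vector_mulmx.
    exact: random_vector_cst.
  have := terminal_decrease Y mY YW.
  rewrite next !(terminal_cost_shift P gf_measurable bf_ge0 gfb)//.
  rewrite (stage_cost_shift P g_continuous b_ge0 gb mY mKY) Sshift ES.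
  have pos (h : Omega -> R) : (forall w, 0 <= h w) ->
      (0 <= \int[P]_w (h w)%:E)%E.
    by move=> h0; apply: integral_ge0 => w _; rewrite lee_fin.
  have a0 := pos (fun w => gf' (Y w)) (fun w => gfb _).
  have b0' := pos (fun w => g' (Y w, K *m Y w + vf)) (fun w => gb _).
  have c0 := pos (fun w => gf' (M *m Y w + B *m vf + W N w)) (fun w => gfb _).
  move: a0 b0' c0 Yoo; rewrite -/(gf' _) -/(g' _).
  case: (\int[P]_w (gf' (Y w))%:E)%E => // a _.
  case: (\int[P]_w (g' (Y w, K *m Y w + vf))%:E)%E => [a1| |] // _;
  case: (\int[P]_w (gf' (M *m Y w + B *m vf + W N w))%:E)%E => [a2| |] // _ _ /(_ (ltry _)).
  - by rewrite !lee_fin; lra.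
  - by [].
  - by [].
  - by [].
have X_random k : random_vector (X k) by exact: cl_state_random.
have U_random k : random_vector (U k) by exact: cl_input_random.
have stage k : stage_cost P g (X k) (U k)
    = ((\int[P]_w (g' (X k w, U k w))%:E) - b%:E)%E.
  exact: stage_cost_shift.
have olE j x (v : N.-tuple 'cV[R]_l) : ol_cost P A B W K j g gf x v
    = (frozen_cost P M B K W j g' gf' N x (fun i => v`_i)
       - (N%:R * b + bf)%:E)%E.
  exact: ol_cost_shift.
(* Recursive feasibility, outcome by outcome: the candidate makes the next problem feasible, so the
   selection is again admissible. *)
have adm j w : ol_admissible P A B W c p e q rho K j V Zf
    (cl_nominal P A B W K vs X0 j w) (error P A B W K X0 j) (vs j w).
  elim: j => [|j IH]; apply: (proj1 (vs_optimal _ w _)) => //.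
  exists (candidate (vs j w) vf); exact: candidate_admissible.
(* Optimality at time [j + 1] tested against the candidate; the finite constant from the shift
   cancels. *)
have candE j w : (cost j.+1 w (fun i => (vs j.+1 w)`_i)
    <= cost j.+1 w (fun i => (candidate (vs j w) vf)`_i))%E.
  have feas : ol_admissible P A B W c p e q rho K j.+1 V Zf
      (cl_nominal P A B W K vs X0 j.+1 w) (error P A B W K X0 j.+1)
      (candidate (vs j w) vf) by exact: candidate_admissible.
  have [_ /(_ _ feas)] := vs_optimal j.+1 w (ex_intro _ _ feas).
  by rewrite !olE leeD2rE.
pose J j := (\int[P]_w cost j w (fun i => (vs j w)`_i))%E.
have Jge0 j : (0 <= J j)%E.
  apply: integral_ge0 => w _; apply: integral_ge0 => w' _.
  by rewrite lee_fin path_cost_ge0.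
have descent j : (J j.+1 + \int[P]_w (g' (X j w, U j w))%:E
    <= J j + (Sr + Cf)%:E)%E.
  exact: (expected_cost_descent N_gt0 X0_random W_random W_law W_independent
    vs_adapted cg' mgf' gb gfb s0 decr candE).
have J0oo : (J 0%N < +oo)%E.
  have nb : 0 <= N%:R * b + bf by rewrite addr_ge0// mulr_ge0.
  move: initially_finite; under eq_integral do rewrite olE.
  rewrite integral_ge0_subC//.
  - change (J 0%N - (N%:R * b + bf)%:E < +oo -> J 0%N < +oo)%E.
    by case: (J 0%N) => [r _| |] //; exact: ltry.
  - exact: measurable_selected_cost.
  - move=> w; apply: integral_ge0 => w' _.
    by rewrite lee_fin; exact: (path_cost_ge0 _ _ _ _ _ _ _ gb gfb).
(* The finite initial value [C] is the constant that the averaging removes. *)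
case EJ : (J 0%N) (Jge0 0%N) J0oo => [C| |] // C0 _.
rewrite Sshift ES -EFinB -EFinD.
apply: (limn_esup_average_le (C := C)) => L.
have := telescoping_sum_le descent L; rewrite EJ -EFinD => le_sum.
have {}le_sum : (\sum_(0 <= k < L) \int[P]_w (g' (X k w, U k w))%:E
    <= (C + L%:R * (Sr + Cf))%:E)%E.
  by apply: le_trans le_sum; rewrite leeDl.
under eq_bigr => k _ do rewrite stage.
(* Undoing the shift subtracts [L * b] from the sum, which turns the slope [Sr + Cf] into
   [Sr - b + Cf]. *)
rewrite big_split/= sumEFin sumr_const_nat subn0 mulNrn -mulr_natl.
apply: (le_trans (leeD2r _ le_sum)); rewrite -EFinD lee_fin.
by rewrite !mulrDr mulrN; lra.
Qed.
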